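(* Let $k$, $k'$, $e$, $\epsilon$, $m$, $n$, $G$, $K$, $X$, $\widetilde{\Lambda}_n^+$ and the matrices $x_\lambda$ be as in the context. Then: (1) The map $\widetilde{\Lambda}_n^+ \to K\backslash X$, $\lambda \mapsto K\cdot x_\lambda$, is surjective. (2) This map is bijective if $m$ is even, or $m=3$, or $e=1$. (3) There are precisely two $G$-orbits in $X$, represented by $x_0=1_m$ and $x_1=\mathrm{Diag}(\pi,1_{m-2},\pi^{-1})$. For $\lambda\in\widetilde{\Lambda}_n^+$, one has $x_\lambda\in G\cdot 1_m$ if and only if $|\lambda|=\sum_{i=1}^n\lambda_i$ is even.
   Context: Let $k$ be a finite extension of $\mathbb{Q}_p$ (a $\mathfrak{p}$-adic field) with ring of integers $\mathcal{O}_k$, prime element $\pi$, residue field of cardinality $q$, and additive valuation $v_\pi$ normalized by $v_\pi(\pi)=1$. Let $k'$ be the unramified quadratic extension of $k$ with ring of integers $\mathcal{O}_{k'}$; write $a\mapsto a^*$ for the nontrivial automorphism of $k'/k$, and for a matrix $a$ over $k'$ let $a^*$ denote its conjugate transpose. Put $e=v_\pi(2)\ge 0$ and fix $\epsilon\in\mathcal{O}_k^\times$ such that $\{1,\frac{1+\sqrt{\epsilon}}{2}\}$ is an $\mathcal{O}_k$-basis of $\mathcal{O}_{k'}$ (so $k'=k(\sqrt\epsilon)$, $(\sqrt\epsilon)^*=-\sqrt\epsilon$ and $v_\pi(1-\epsilon)=2e$). Let $m\ge 2$, $n=\lfloor m/2\rfloor$, and let $j_m$ be the $m\times m$ matrix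 with all anti-diagonal entries $1$ and all other entries $0$. Let $G=\{g\in GL_m(k'): g^*j_mg=j_m\}$, $X=\{x\in G: x^*=x,\ \det(t1_m-xj_m)=\det(t1_m-j_m)\}$, with $G$ acting on $X$ by $g\cdot x=gxg^*$, and $K=G\cap M_m(\mathcal{O}_{k'})$. Let $\widetilde{\Lambda}_n^+=\{\lambda\in\mathbb{Z}^n:\lambda_1\ge\lambda_2\ge\cdots\ge\lambda_n\ge -e\}$. For $\lambda\in\widetilde{\Lambda}_n^+$ define $x_\lambda\in X$ to be the $m\times m$ matrix whose only nonzero entries are: for each $i\le n$ with $\lambda_i\ge 0$, the $(i,i)$-entry $\pi^{\lambda_i}$ and the $(m+1-i,m+1-i)$-entry $\pi^{-\lambda_i}$; for each $i\le n$ with $\lambda_i<0$, the $(i,i)$-entry $\pi^{\lambda_i}(1-\epsilon)$, the $(i,m+1-i)$-entry $-\sqrt{\epsilon}$, the $(m+1-i,i)$-entry $\sqrt\epsilon$ and the $(m+1-i,m+1-i)$-entry $\pi^{-\lambda_i}$; and, if $m$ is odd, the $(n+1,n+1)$-entry $1$. *)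

(* Defs.v *)
From HB Require Import structures.
From mathcomp Require Import all_boot all_order all_algebra all_field.
From mathcomp Require Import classical_sets functions.

Set Implicit Arguments.
Unset Strict Implicit.
Unset Printing Implicit Defensive.

Import Order.TTheory GRing.Theory Num.Theory.
Local Open Scope classical_set_scope.
Local Open Scope ring_scope.

(* Valuations are functions F -> int whose value at 0 is irrelevant; the
   convention v(0) = +oo is built into [val_ge]. *)

Definition val_ge (F : fieldType) (v : F -> int) (N : int) : set F :=
  [set x | x = 0 \/ N <= v x].

Record normalized_valuation (F : fieldType) (v : F -> int) : Prop := {
  valM : forall x y, x != 0 -> y != 0 -> v (x * y) = v x + v y;
  valD : forall N x y, val_ge v N x -> val_ge v N y -> val_ge v N (x + y);
  val_norm : exists2 x, x != 0 & v x = 1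
}.

Definition integers (F : fieldType) (v : F -> int) : set F := val_ge v 0.

Definition prime_element (F : fieldType) (v : F -> int) (x : F) : Prop :=
  x != 0 /\ v x = 1.

Definition integer_unit (F : fieldType) (v : F -> int) (x : F) : Prop :=
  x != 0 /\ v x = 0.

Definition val_cauchy (F : fieldType) (v : F -> int) (u : nat -> F) : Prop :=
  forall N, exists n0 : nat,
    forall i j : nat, (n0 <= i)%N -> (n0 <= j)%N -> val_ge v N (u i - u j).

Definition val_cvg (F : fieldType) (v : F -> int) (u : nat -> F) (l : F) :
    Prop :=
  forall N, exists n0 : nat,
    forall i : nat, (n0 <= i)%N -> val_ge v N (u i - l).

Definition rat_val (p : nat) (x : rat) : int :=
  (logn p `|numq x|%N)%:Z - (logn p `|denq x|%N)%:Z.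

(* (F, v) is the field Q_p with its valuation v_p, i.e. the completion of Q for
   the p-adic valuation; this determines (F, v) up to unique isomorphism. *)
Record is_Qp (p : nat) (F : fieldType) (v : F -> int) : Prop := {
  Qp_prime : prime p;
  Qp_val : normalized_valuation v;
  Qp_rat : forall x : rat, x != 0 ->
    (ratr x : F) != 0 /\ v (ratr x) = rat_val p x;
  Qp_dense : forall (x : F) (N : int), exists y : rat, val_ge v N (x - ratr y);
  Qp_complete : forall u, val_cauchy v u -> exists l, val_cvg v u l
}.

(* v' extends v up to normalization, with ramification index r. *)
Definition ramification_index (F : fieldType) (L : fieldExtType F)
    (v : F -> int) (v' : L -> int) (r : nat) : Prop :=
  (0 < r)%N /\ forall x, x != 0 -> v' x%:A = r%:Z * v x.

Definition unramified_quadratic (F : fieldType) (L : fieldExtType F)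
    (v : F -> int) (v' : L -> int) : Prop :=
  \dim {:L} = 2%N /\ ramification_index v v' 1.

Definition nontrivial_automorphism (F : fieldType) (L : fieldExtType F)
    (sigma : {lrmorphism L -> L}) : Prop :=
  bijective sigma /\ exists x, sigma x <> x.

Definition integral_basis2 (F : fieldType) (L : fieldExtType F)
    (v : F -> int) (v' : L -> int) (b1 b2 : L) : Prop :=
  integers v' b1 /\ integers v' b2 /\
  forall x, integers v' x ->
    exists! c : F * F, [/\ integers v c.1, integers v c.2
                         & x = c.1 *: b1 + c.2 *: b2].

Section UnitaryHermitian.
Variables (k : fieldType) (k' : fieldExtType k) (sigma : {lrmorphism k' -> k'}).
Variable m : nat.

Definition antidiag : 'M[k']_m := \matrix_(i, j) (j == rev_ord i)%:R.

Definition conj_tr (a : 'M[k']_m) : 'M[k']_m := map_mx sigma a^T.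

Definition unitary_group : set 'M[k']_m :=
  [set g | g \in unitmx /\ conj_tr g *m antidiag *m g = antidiag].

Definition herm_space : set 'M[k']_m :=
  [set x | [/\ unitary_group x, conj_tr x = x
             & char_poly (x *m antidiag) = char_poly antidiag]].

Definition integral_unitary_group (v' : k' -> int) : set 'M[k']_m :=
  unitary_group `&` [set g | forall i j, integers v' (g i j)].

Definition orbit_of (H : set 'M[k']_m) (x : 'M[k']_m) : set 'M[k']_m :=
  [set g *m x *m conj_tr g | g in H].

Definition orbit_space (H : set 'M[k']_m) : set (set 'M[k']_m) :=
  [set orbit_of H x | x in herm_space].

Definition Lambda (e : int) : set {ffun 'I_m./2 -> int} :=
  [set l | (forall a b : 'I_m./2, (a <= b)%N -> l b <= l a) /\
           forall a, - e <= l a].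

Lemma leq_half_self : (m./2 <= m)%N.
Proof. by rewrite -{2}(odd_double_half m) -addnn addnA leq_addl. Qed.

(* With indices counted from 0, the 1-based index pair (i, m+1-i) becomes
   (lo a, hi a) for a = i-1. *)
Definition lo (a : 'I_m./2) : 'I_m := widen_ord leq_half_self a.
Definition hi (a : 'I_m./2) : 'I_m := rev_ord (lo a).

Definition x_block (pi eps : k) (sqrt_eps : k') (a : 'I_m./2) (z : int) :
    'M[k']_m :=
  if 0 <= z then
    (pi ^ z)%:A *: delta_mx (lo a) (lo a)
    + (pi ^ (- z))%:A *: delta_mx (hi a) (hi a)
  else
    (pi ^ z * (1 - eps))%:A *: delta_mx (lo a) (lo a)
    - sqrt_eps *: delta_mx (lo a) (hi a)
    + sqrt_eps *: delta_mx (hi a) (lo a)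
    + (pi ^ (- z))%:A *: delta_mx (hi a) (hi a).

Definition x_middle : 'M[k']_m :=
  \matrix_(i, j) [&& odd m, val i == m./2 & val j == m./2]%:R.

Definition x_lambda (pi eps : k) (sqrt_eps : k') (l : {ffun 'I_m./2 -> int}) :
    'M[k']_m :=
  \sum_a x_block pi eps sqrt_eps a (l a) + x_middle.

Definition x_one (pi : k) : 'M[k']_m :=
  diag_mx (\row_i (if val i == 0%N then pi%:A
                   else if val i == m.-1 then (pi^-1)%:A else 1)).

End UnitaryHermitian.
Arguments antidiag {k} k' m.
Arguments x_middle {k} k' m.
Arguments x_one {k} k' m pi.

(* Main.v *)
(* With s := x j, the space X is the set of involutions s of the hermitian lattice
   L = O'^m, with form h(y, z) = y^* j z, whose (-1)-eigenspace has dimension n, and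
   K acts on them as the unitary group of L.

   Invariants: x_lambda - j = C diag(pi^-lambda) C^* with C integral containing an
   identity block, so x_mu = g x_lambda g^* yields
   P diag(pi^-lambda) P^* = diag(pi^-mu) with P integral if g is.  Comparing
   elementary divisors recovers lambda from the K-orbit; comparing determinants
   recovers the parity of |lambda| from the G-orbit.

   Surjectivity: take u in L with h(u, (1 - s) u) of minimal valuation l.  One has
   l <= e because 1 - s acts as 2 on its image.  Since unit norms are surjective and
   units congruent to 1 modulo pi^i are norms of such units, u can be corrected to an
   isotropic integral vector y with h(y, s y) = pi^l; then y and s y span an s-stable
   plane on which s acts through the block of lambda = - l, and one proceeds in its
   orthogonal complement.  Starting with the smallest l makes lambda decreasing.

   For G-orbits only the diagonal hermitian form diag(pi^-lambda) matters, and
   (lambda_0, lambda_a) can be replaced by (lambda_0 + lambda_a, 0). *)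
From mathcomp Require Import all_boot all_order all_algebra all_field.
From mathcomp Require Import classical_sets functions boolp.
From mathcomp Require Import zify ring.
Require Import Defs.

Set Implicit Arguments.
Unset Strict Implicit.
Unset Printing Implicit Defensive.

Import Order.TTheory GRing.Theory Num.Theory.
Local Open Scope ring_scope.

(** * Discrete valuations *)

Section Valuation.

Variables (F : fieldType) (v : F -> int).
Hypothesis hv : normalized_valuation v.

Lemma val1 : v 1 = 0.
Proof.
have : v 1 = v 1 + v 1 by rewrite -(valM hv) ?mulr1 ?oner_neq0.
lia.
Qed.

Lemma valN x : v (- x) = v x.
Proof.
have [->|x_neq0] := eqVneq x 0; first by rewrite oppr0.
have N1_neq0 : (-1 : F) != 0 by rewrite oppr_eq0 oner_neq0.
have vN1 : v (-1) + v (-1) = 0 by rewrite -(valM hv) // mulrNN mulr1 val1.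
by rewrite -mulN1r (valM hv) //; lia.
Qed.

Lemma valV x : x != 0 -> v x^-1 = - v x.
Proof.
move=> x_neq0; have : v x + v x^-1 = 0.
  by rewrite -(valM hv) ?invr_eq0 // divff // val1.
lia.
Qed.

Lemma val_div x y : x != 0 -> y != 0 -> v (x / y) = v x - v y.
Proof. by move=> x0 y0; rewrite (valM hv) ?invr_eq0 // valV. Qed.

Lemma valX x n : x != 0 -> v (x ^+ n) = n%:Z * v x.
Proof.
move=> x0; elim: n => [|n IH]; first by rewrite expr0 val1 mul0r.
by rewrite exprS (valM hv) ?expf_neq0 // IH intS mulrDl mul1r.
Qed.

Lemma valXz x (n : int) : x != 0 -> v (x ^ n) = n * v x.
Proof.
move=> x0; case: n => n; first exact: valX.
by rewrite NegzE -exprnN valV ?expf_neq0 // valX // mulNr.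
Qed.

Lemma val_ge0 N : val_ge v N 0.
Proof. by left. Qed.

Lemma val_ge_val x : val_ge v (v x) x.
Proof. by right. Qed.

Lemma val_ge_eq N x : v x = N -> val_ge v N x.
Proof. by move=> <-; right. Qed.

Lemma val_geE N x : x != 0 -> val_ge v N x -> N <= v x.
Proof. by move=> x0 [xz|//]; rewrite xz eqxx in x0. Qed.

Lemma val_ge_le N M x : M <= N -> val_ge v N x -> val_ge v M x.
Proof. by move=> le_MN [->|le_Nx]; [left|right; apply: le_trans le_Nx]. Qed.

Lemma val_geN N x : val_ge v N x -> val_ge v N (- x).
Proof. by move=> [->|h]; [left; rewrite oppr0|right; rewrite valN]. Qed.

Lemma val_geB N x y : val_ge v N x -> val_ge v N y -> val_ge v N (x - y).
Proof. by move=> hx hy; apply: (valD hv) => //; apply: val_geN. Qed.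

Lemma val_ge_sym N x y : val_ge v N (x - y) -> val_ge v N (y - x).
Proof. by rewrite -opprB => /val_geN; rewrite opprK. Qed.

Lemma val_ge_trans N y x z :
  val_ge v N (x - y) -> val_ge v N (y - z) -> val_ge v N (x - z).
Proof. by move=> xy yz; rewrite -(subrKA y); apply: (valD hv). Qed.

Lemma val_geM N M x y :
  val_ge v N x -> val_ge v M y -> val_ge v (N + M) (x * y).
Proof.
have [->|x0] := eqVneq x 0; first by rewrite mul0r; left.
have [->|y0] := eqVneq y 0; first by rewrite mulr0; left.
move=> /(val_geE x0) hx /(val_geE y0) hy.
by right; rewrite (valM hv) //; apply: lerD.
Qed.

Lemma val_geMl N x y : val_ge v 0 x -> val_ge v N y -> val_ge v N (x * y).
Proof. by move=> hx hy; rewrite -(add0r N); apply: val_geM. Qed.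

Lemma val_geMr N x y : val_ge v N x -> val_ge v 0 y -> val_ge v N (x * y).
Proof. by move=> hx hy; rewrite -(addr0 N); apply: val_geM. Qed.

Lemma val_ge_sum (I : Type) (r : seq I) (P : pred I) (f : I -> F) N :
  (forall i, P i -> val_ge v N (f i)) -> val_ge v N (\sum_(i <- r | P i) f i).
Proof.
move=> hf; elim/big_ind: _ => //; first exact: val_ge0.
by move=> x y; apply: (valD hv).
Qed.

Lemma val_ge_nat n : val_ge v 0 n%:R.
Proof.
elim: n => [|n IH]; first exact: val_ge0.
by rewrite -addn1 natrD; apply: (valD hv) => //; right; rewrite val1.
Qed.

Lemma val_ge_int (n : int) : val_ge v 0 n%:~R.
Proof.
case: n => n; first exact: val_ge_nat.
by rewrite NegzE mulrNz; apply: val_geN; apply: (val_ge_nat n.+1).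
Qed.

Lemma val_ge_all0 x : (forall n : nat, val_ge v n x) -> x = 0.
Proof.
move=> h; have [//|x0] := eqVneq x 0.
by have := val_geE x0 (h (`|v x|.+1)%N); lia.
Qed.

Lemma val_ge_mulf_cancel N M c x :
  c != 0 -> v c = M -> val_ge v N (c * x) -> val_ge v (N - M) x.
Proof.
move=> c0 vc h; rewrite -(mulKf c0 x) addrC.
by apply: val_geM => //; right; rewrite valV // vc.
Qed.

Lemma valD_lt x y : x != 0 -> val_ge v (v x + 1) y ->
  x + y != 0 /\ v (x + y) = v x.
Proof.
move=> x0 hy.
have x_small : ~ val_ge v (v x + 1) x by move=> /(val_geE x0); lia.
have xy0 : x + y != 0.
  by apply/eqP => /eqP; rewrite addr_eq0 => /eqP xy; apply: x_small; rewrite {2}xy; apply: val_geN.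
split=> //.
have le_xy : v x <= v (x + y).
  apply: val_geE => //; apply: (valD hv); first exact: val_ge_val.
  by apply: val_ge_le hy; lia.
have [//|ne] := eqVneq (v (x + y)) (v x); case: x_small.
rewrite -{2}(addrK y x); apply: val_geB => //.
by right; rewrite lezD1 lt_neqAle eq_sym ne.
Qed.

Lemma integer_unit1 : integer_unit v 1.
Proof. by split; [exact: oner_neq0|exact: val1]. Qed.

Lemma integer_unitM x y :
  integer_unit v x -> integer_unit v y -> integer_unit v (x * y).
Proof.
by move=> [x0 vx] [y0 vy]; split; rewrite ?mulf_neq0 // (valM hv) // vx vy.
Qed.

Lemma integer_unitN x : integer_unit v x -> integer_unit v (- x).
Proof. by move=> [x0 vx]; split; rewrite ?oppr_eq0 // valN. Qed.

Lemma integer_unitV x : integer_unit v x -> integer_unit v x^-1.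
Proof. by move=> [x0 vx]; split; rewrite ?invr_eq0 // valV // vx. Qed.

Lemma integer_unit_div x y :
  x != 0 -> y != 0 -> v x = v y -> integer_unit v (x / y).
Proof.
move=> x0 y0 e; split; first by rewrite mulf_neq0 ?invr_eq0.
by rewrite val_div // e subrr.
Qed.

Lemma integer_unit_integer x : integer_unit v x -> val_ge v 0 x.
Proof. by move=> [_ /val_ge_eq]. Qed.

Lemma integer_not_unit x :
  val_ge v 0 x -> ~ integer_unit v x -> val_ge v 1 x.
Proof.
move=> hx nu; have [->|x0] := eqVneq x 0; [by left|right].
have := val_geE x0 hx; have : v x <> 0 by move=> vx; apply: nu.
lia.
Qed.

Lemma integer_unit_near N u x :
  0 < N -> integer_unit v u -> val_ge v N (x - u) -> integer_unit v x.
Proof.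
move=> N_gt0 [u0 vu] xu; rewrite -(subrK u x) addrC.
have [|xu0 vxu] := valD_lt (y := x - u) u0; last by split; rewrite ?vxu.
by apply: val_ge_le xu; rewrite vu; lia.
Qed.

End Valuation.

Definition series_complete (F : fieldType) (v : F -> int) : Prop :=
  forall d : nat -> F, (forall n : nat, val_ge v n (d n)) ->
  exists l, forall n : nat, val_ge v n (l - \sum_(i < n) d i).

Lemma val_ge_series_tail (F : fieldType) (v : F -> int) (d : nat -> F) :
  normalized_valuation v -> (forall n : nat, val_ge v n (d n)) ->
  forall n m : nat, (n <= m)%N ->
  val_ge v n (\sum_(i < m) d i - \sum_(i < n) d i).
Proof.
move=> hv hd n m nm; rewrite -!(big_mkord xpredT d).
rewrite (big_cat_nat _ nm) //= addrAC subrr add0r.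
rewrite big_nat_cond; apply: val_ge_sum => // i; rewrite andbT => /andP[ni _].
by apply: val_ge_le (hd i).
Qed.

Lemma series_complete_shift (F : fieldType) (v : F -> int) (N : int) (d : nat -> F) :
  normalized_valuation v -> series_complete v ->
  (forall n : nat, val_ge v (N + n) (d n)) ->
  exists l, forall n : nat, val_ge v (N + n) (l - \sum_(i < n) d i).
Proof.
move=> hv complete hd; have [w w0 vw] := val_norm hv.
have wN0 : w ^ N != 0 by rewrite expfz_neq0.
have vwN : v (w ^ N) = N by rewrite (valXz hv) // vw mulr1.
have [n|l hl] := complete (fun n => d n / w ^ N).
  have -> : n%:Z = N + n%:Z - N by lia.
  by apply: (val_ge_mulf_cancel hv wN0) => //; rewrite mulrC divfK.
exists (l * w ^ N) => n; rewrite -(divfK wN0 (\sum_(i < n) d i)) -mulrBl addrC.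
by apply: (val_geM hv) (val_ge_eq vwN); rewrite mulr_suml.
Qed.

(** * Completeness and residue field of a finite extension of Q_p *)

Definition finite_residues (F : fieldType) (v : F -> int) : Prop :=
  exists (T : finType) (rep : T -> F), (forall t, val_ge v 0 (rep t)) /\
    forall y, val_ge v 0 y -> exists t, val_ge v 1 (y - rep t).

Lemma linear_congruence_solvable (p : nat) (n d : int) :
  (0 < p)%N -> coprimez p d -> exists a : 'I_p, (p %| n - a%:Z * d)%Z.
Proof.
move=> p_gt0 /eqP pd; have [s [t]] := Bezoutz p d; rewrite pd => st.
have p_neq0 : p%:Z != 0 by lia.
have aE : `|(t * n %% p)%Z|%N%:Z = (t * n %% p)%Z by rewrite gez0_abs // modz_ge0.
have lt_ap : (`|(t * n %% p)%Z| < p)%N by rewrite -ltz_nat aE ltz_pmod.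
exists (Ordinal lt_ap); rewrite /= aE; set q := (t * n %/ p)%Z.
have -> : (t * n %% p)%Z = t * n - q * p by rewrite {2}(divz_eq (t * n) p) addrC addKr.
have -> : n - (t * n - q * p) * d = (n * s + q * d) * p by rewrite -{1}[n]mulr1 -st; ring.
exact: dvdz_mull.
Qed.

Lemma scaler_natX (R : pzRingType) (A : lalgType R) (p j : nat) (x : A) :
  p%:R ^+ j *: x = p%:R ^+ j * x.
Proof. by rewrite -!natrX scaler_nat mulr_natl. Qed.

Section Qp.

Variables (p : nat) (Qp : fieldType) (vp : Qp -> int).
Hypothesis hQp : is_Qp p vp.

Let hvp := Qp_val hQp.
Let p_prime := Qp_prime hQp.

Lemma Qp_int (n : int) : n != 0 ->
  (n%:~R : Qp) != 0 /\ vp n%:~R = logn p `|n|%N.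
Proof.
move=> n0; have nQ : n%:~R != 0 :> rat by rewrite intr_eq0.
have [n_neq0 vn] := Qp_rat hQp nQ.
rewrite ratr_int in n_neq0 vn; split=> //; rewrite vn /rat_val.
by rewrite numq_int denq_int logn1 subr0.
Qed.

Lemma Qp_pchar : [pchar Qp] =i pred0.
Proof.
apply/pcharf0P => n; have [->|n0] := eqVneq n 0%N; first by rewrite eqxx.
by apply/negbTE; have [] := @Qp_int n%:Z n0.
Qed.

Lemma Qp_prime_element : prime_element vp p%:R.
Proof.
have [|p0 vpp] := @Qp_int p%:Z; first by have := prime_gt0 p_prime; lia.
by split=> //; rewrite vpp absz_nat logn_prime // eqxx.
Qed.

Lemma Qp_int_dvd (n : int) : val_ge vp 1 n%:~R <-> (p %| n)%Z.
Proof.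
have [p0 vpp] := Qp_prime_element; split=> [|/dvdzP[q ->]].
  have [->|n0] := eqVneq n 0; first by rewrite dvdz0.
  have [n_neq0 vn] := Qp_int n0 => /(val_geE n_neq0).
  by rewrite vn lez_nat logn_gt0 mem_primes => /and3P[].
rewrite rmorphM /=; apply: (val_geMl hvp); first exact: val_ge_int.
exact: val_ge_eq.
Qed.

Lemma Qp_integral_denq (y : rat) : val_ge vp 0 (ratr y) -> coprimez p (denq y).
Proof.
move=> y_int; rewrite /coprimez /gcdz absz_nat eqz_nat.
apply: contraT; rewrite -/(coprime _ _) prime_coprime // negbK => p_denq.
suff p_numq : (p %| `|numq y|)%N.
  have : (p %| gcdn `|numq y| `|denq y|)%N by rewrite dvdn_gcd p_numq.
  by rewrite (eqP (coprime_num_den y)) dvdn1 => /eqP p1; have := p_prime; rewrite p1.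
apply/(Qp_int_dvd (numq y)).
have -> : (numq y)%:~R = ratr y * (denq y)%:~R :> Qp.
  by have [d0 _] := Qp_int (denq_neq0 y); rewrite divfK.
by apply: (val_geMl hvp) => //; apply/Qp_int_dvd.
Qed.

Lemma Zp_residue (x : Qp) : val_ge vp 0 x ->
  exists a : 'I_p, val_ge vp 1 (x - a%:R).
Proof.
move=> x_int; have [y xy] := Qp_dense hQp x 1.
have y_int : val_ge vp 0 (ratr y).
  by rewrite -[ratr y](subKr x); apply: (val_geB hvp) => //; apply: val_ge_le xy.
have p_denq := Qp_integral_denq y_int.
have [d0 vd] := Qp_int (denq_neq0 y).
have d_unit : integer_unit vp (denq y)%:~R by split=> //; rewrite vd logn_coprime.
have [a /Qp_int_dvd p_dvd] := linear_congruence_solvable (numq y) (prime_gt0 p_prime) p_denq.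
exists a; apply: (val_ge_trans hvp xy).
have -> : ratr y - a%:R = (numq y - a%:Z * denq y)%:~R / (denq y)%:~R :> Qp.
  by rewrite rmorphB rmorphM /= mulrBl mulfK.
by apply: (val_geMr hvp) => //; apply/integer_unit_integer/integer_unitV.
Qed.

Lemma Qp_series_complete : series_complete vp.
Proof.
move=> d hd; have tail := val_ge_series_tail hvp hd.
have [|l hl] := Qp_complete hQp (u := fun n => \sum_(i < n) d i).
  move=> N; exists `|N|%N => i j hi hj.
  have [ij|/ltnW ij] := leqP j i.
    by apply: val_ge_le (tail _ _ ij); lia.
  by apply/(val_ge_sym hvp)/(val_ge_le _ (tail _ _ ij)); lia.
exists l => n; have [n1 /(_ _ (leq_maxl n1 n)) near_l] := hl n.
apply: (val_ge_trans hvp (y := \sum_(i < maxn n1 n) d i)); first exact: val_ge_sym.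
exact: tail (leq_maxr n1 n).
Qed.

Variables (k : fieldExtType Qp) (v : k -> int) (r : nat).
Hypotheses (hv : normalized_valuation v) (hr : ramification_index vp v r).

Lemma val_ge_scaler N (a : Qp) x :
  val_ge vp N a -> val_ge v 0 x -> val_ge v (r%:Z * N) (a *: x).
Proof.
move=> ha hx; rewrite -mulr_algl; apply: (val_geMr hv) => //.
have [->|a0] := eqVneq a 0; first by rewrite scale0r; left.
right; rewrite (hr.2 _ a0) ler_pM2l; first exact: val_geE a0 ha.
by rewrite ltz_nat hr.1.
Qed.

Lemma val_ge_int_combination t N (a : 'I_t -> Qp) (x : 'I_t -> k) :
  (forall i, val_ge vp N (a i)) -> (forall i, val_ge v 0 (x i)) ->
  val_ge v (r%:Z * N) (\sum_i a i *: x i).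
Proof. by move=> ha hx; apply: (val_ge_sum hv) => i _; apply: val_ge_scaler. Qed.

Lemma val_natX n : (p%:R ^+ n : k) != 0 /\ v (p%:R ^+ n) = r%:Z * n%:Z.
Proof.
have [p0 vpp] := Qp_prime_element.
have pE : (p%:R : k) = (p%:R : Qp)%:A by rewrite scaler_nat.
have p0' : (p%:R : k) != 0 by rewrite pE scaler_eq0 (negPf p0) oner_eq0.
by rewrite expf_neq0 // (valX hv) // pE (hr.2 _ p0) vpp mulr1 mulrC.
Qed.

(* Linear independence over F_p of the classes of the x_i modulo p. *)
Definition p_independent t (x : 'I_t -> k) : Prop :=
  (forall i, val_ge v 0 (x i)) /\
  forall a : 'I_t -> Qp, (forall i, val_ge vp 0 (a i)) ->
    val_ge v r (\sum_i a i *: x i) -> forall i, val_ge vp 1 (a i).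

Definition generates_mod N t (x : 'I_t -> k) : Prop :=
  (forall i, val_ge v 0 (x i)) /\
  forall y, val_ge v 0 y -> exists2 a : 'I_t -> Qp,
    (forall i, val_ge vp 0 (a i)) & val_ge v N (y - \sum_i a i *: x i).

(* A linear relation, divided by a coefficient of least valuation, would be a
   nontrivial relation modulo p. *)
Lemma p_independent_dim t (x : 'I_t -> k) : p_independent x ->
  (t <= \dim {:k})%N.
Proof.
move=> [_ x_ind].
suff /eqP x_free : free (mktuple x).
  by rewrite -[t in (t <= _)%N](size_tuple (mktuple x)) -x_free dimvS ?subvf.
apply/freeP => a relation.
have [/forallP a0 i|] := boolP [forall i, a i == 0]; first exact/eqP.
rewrite negb_forall => /existsP[i1 ai1].
case: (@arg_minP _ _ _ i1 (fun i => a i != 0) (fun i => vp (a i)) ai1) => i0 ai0 i0min.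
have := x_ind (fun i => a i / a i0) _ _ i0; rewrite divff //.
case=> [i||/eqP|]; rewrite ?oner_eq0 ?(val1 hvp) //.
- have [->|ai] := eqVneq (a i) 0; first by rewrite mul0r; left.
  by right; rewrite (val_div hvp) // subr_ge0 i0min.
- suff -> : \sum_i (a i / a i0) *: x i = 0 by left.
  transitivity ((a i0)^-1 *: \sum_i a i *: (mktuple x)`_i); last by rewrite relation scaler0.
  rewrite scaler_sumr.
  by apply: eq_bigr => i _; rewrite scalerA mulrC nth_mktuple.
Qed.

Lemma p_independent_cons t (x : 'I_t -> k) y : p_independent x -> val_ge v 0 y ->
  ~ (exists2 a : 'I_t -> Qp, (forall i, val_ge vp 0 (a i)) &
       val_ge v r (y - \sum_i a i *: x i)) ->
  p_independent (fun i => oapp x y (unlift ord0 i)).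
Proof.
move=> [x_int x_ind] y_int not_spanned; split=> [i|a a_int].
  by case: unliftP => /=.
rewrite big_ord_recl unlift_none /=; under eq_bigr do rewrite liftK /=.
move=> relation.
have a0_nonunit : val_ge vp 1 (a ord0).
  apply: integer_not_unit => // a0_unit; apply: not_spanned.
  have inv_int := integer_unit_integer (integer_unitV hvp a0_unit).
  exists (fun i => - (a ord0)^-1 * a (lift ord0 i)) => [i|].
    by apply: (val_geMl hvp) => //; apply: (val_geN hvp).
  have -> : y - \sum_i (- (a ord0)^-1 * a (lift ord0 i)) *: x i =
      (a ord0)^-1%:A * (a ord0 *: y + \sum_i a (lift ord0 i) *: x i).
    rewrite mulr_algl scalerDr scalerA mulVf ?a0_unit.1 // scale1r scaler_sumr -sumrN.
    by congr (_ + _); apply: eq_bigr => i _; rewrite mulNr scaleNr opprK scalerA.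
  apply: (val_geMl hv) relation; rewrite -(mulr0 r%:Z).
  by apply: val_ge_scaler => //; apply: (val_ge_nat hv 1).
have tail_nonunit : forall i, val_ge vp 1 (a (lift ord0 i)).
  apply: x_ind => [i|]; first exact: a_int.
  have -> : \sum_i a (lift ord0 i) *: x i =
    (a ord0 *: y + \sum_i a (lift ord0 i) *: x i) - a ord0 *: y by rewrite addrC addKr.
  by apply: (val_geB hv) => //; rewrite -[r%:Z]mulr1; apply: val_ge_scaler.
by move=> i; case: (unliftP ord0 i) => [j|] ->.
Qed.

Lemma generates_mod_p : exists t (x : 'I_t -> k), generates_mod r x.
Proof.
pose P t := `[< exists x : 'I_t -> k, p_independent x >].
have exP : exists t, P t.
  exists 0%N; apply/asboolP; exists (fun=> 0).
  by split=> [|a _ _]; case.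
have ubP t : P t -> (t <= \dim {:k})%N by move=> /asboolP[x]; apply: p_independent_dim.
case: (ex_maxnP exP ubP) => t /asboolP[x x_indep] tmax.
exists t, x; split=> [|y y_int]; first exact: x_indep.1.
apply: contrapT => not_spanned; suff /tmax : P t.+1 by rewrite ltnn.
apply/asboolP; eexists; exact: p_independent_cons x_indep y_int not_spanned.
Qed.

Lemma generates_mod_p_division t (x : 'I_t -> k) : generates_mod r x ->
  forall y, exists ay : ('I_t -> Qp) * k, val_ge v 0 y ->
    [/\ forall i, val_ge vp 0 (ay.1 i), val_ge v 0 ay.2 &
        y = \sum_i ay.1 i *: x i + p%:R * ay.2].
Proof.
move=> [x_int gen] y.
have [y_int|] := pselect (val_ge v 0 y); last by exists (fun=> 0, 0).
have [a a_int ha] := gen y y_int; have [p0 vpr] := val_natX 1.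
exists (a, p%:R^-1 * (y - \sum_i a i *: x i)) => _; split=> //=.
  rewrite -(subrr r%:Z); apply: (val_ge_mulf_cancel hv p0); first by rewrite vpr mulr1.
  by rewrite mulVKf.
by rewrite mulVKf // addrC subrK.
Qed.

Lemma generates_mod_p_exact t (x : 'I_t -> k) : generates_mod r x ->
  forall y, val_ge v 0 y -> exists2 a : 'I_t -> Qp,
    (forall i, val_ge vp 0 (a i)) & y = \sum_i a i *: x i.
Proof.
move=> gen y0 y0_int; have [f hf] := choice (generates_mod_p_division gen).
pose y_ n := iter n (fun y => (f y).2) y0.
have y_int n : val_ge v 0 (y_ n) by elim: n => //= n /hf[].
pose d i n := p%:R ^+ n * (f (y_ n)).1 i.
have [p0 vpp] := Qp_prime_element.
have hd i (n : nat) : val_ge vp n (d i n).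
  apply: (val_geMr hvp); last by have [] := hf _ (y_int n).
  by apply: val_ge_eq; rewrite (valX hvp) // vpp mulr1.
have expansion n :
    y0 = \sum_i (\sum_(j < n) d i j) *: x i + p%:R ^+ n * y_ n.
  elim: n => [|n IH].
    by rewrite mul1r big1 ?add0r // => i _; rewrite big_ord0 scale0r.
  rewrite {1}IH; have [_ _ {1}->] := hf _ (y_int n).
  rewrite mulrDr mulrA -exprSr addrA mulr_sumr -big_split; congr (_ + _).
  apply: eq_bigr => i _ /=.
  by rewrite big_ord_recr /= scalerDl -scalerA scaler_natX.
have [l hl] := choice (fun i => Qp_series_complete (hd i)).
exists l => [i|]; first by have := hl i 0%N; rewrite big_ord0 subr0.
apply/eqP; rewrite -subr_eq0; apply/eqP; apply: (val_ge_all0 (v := v)) => n.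
have -> : y0 - \sum_i l i *: x i =
    p%:R ^+ n * y_ n - \sum_i (l i - \sum_(j < n) d i j) *: x i.
  under [in RHS]eq_bigr do rewrite scalerBl.
  by rewrite sumrB opprB {1}(expansion n) addrAC addrC.
apply: (@val_ge_le _ _ (r%:Z * n)); first by rewrite -PoszM lez_nat leq_pmull // hr.1.
apply: (val_geB hv); last exact: val_ge_int_combination gen.1.
by apply: (val_geMr hv) => //; apply: val_ge_eq; have [] := val_natX n.
Qed.

(* The terms are summed in groups of r consecutive ones: the j-th group is
   divisible by p ^ j. *)
Lemma finite_extension_complete : series_complete v.
Proof.
move=> d hd; have [t [x gen]] := generates_mod_p.
have [p0 vpp] := Qp_prime_element.
have coordinates (n : nat) : exists c : 'I_t -> Qp, (forall i, val_ge vp n (c i)) /\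
    \sum_(n * r <= j < n.+1 * r) d j = \sum_i c i *: x i.
  have [pn0 vpn] := val_natX n; set y := \sum_(_ <= _ < _) _.
  have y_int : val_ge v 0 (p%:R ^- n * y).
    rewrite -(subrr (r%:Z * n)); apply: (val_ge_mulf_cancel hv pn0) => //.
    rewrite mulVKf // /y big_nat_cond; apply: (val_ge_sum hv) => j /andP[/andP[nj _] _].
    by apply: val_ge_le (hd j); rewrite mulrC -PoszM lez_nat.
  have [a a_int ha] := generates_mod_p_exact gen y_int.
  exists (fun i => p%:R ^+ n * a i); split=> [i|].
    by apply: (val_geMr hvp) => //; apply: val_ge_eq; rewrite (valX hvp) // vpp mulr1.
  rewrite -[y](mulVKf pn0) ha mulr_sumr.
  by apply: eq_bigr => i _; rewrite -scalerA scaler_natX.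
have [c hc] := choice coordinates.
have [l hl] := choice (fun i => Qp_series_complete (fun n => (hc n).1 i)).
exists (\sum_i l i *: x i) => n.
have le_n_nr : (n <= n * r)%N by rewrite leq_pmulr // hr.1.
apply: (val_ge_trans hv) (val_ge_series_tail hv hd le_n_nr).
have -> : \sum_i l i *: x i - \sum_(j < n * r) d j = \sum_i (l i - \sum_(j < n) c j i) *: x i.
  under [in RHS]eq_bigr do rewrite scalerBl scaler_suml.
  rewrite sumrB exchange_big /= -(big_mkord xpredT d) big_nat_mul big_mkord; congr (_ - _).
  by apply: eq_bigr => j _; rewrite (hc j).2.
apply: (@val_ge_le _ _ (r%:Z * n)); first by rewrite mulrC.
exact: val_ge_int_combination gen.1.
Qed.

Lemma finite_extension_residues : finite_residues v.
Proof.
have [t [x [x_int gen]]] := generates_mod_p.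
exists {ffun 'I_t -> 'I_p}, (fun f : {ffun 'I_t -> 'I_p} => \sum_i (f i)%:R *: x i).
split=> [f|y y_int].
  by rewrite -(mulr0 r%:Z); apply: val_ge_int_combination => // i; apply: val_ge_nat.
have [a a_int ya] := gen y y_int.
have [b ab] := choice (fun i => Zp_residue (a_int i)).
exists (finfun b); apply: (@val_ge_le _ _ r); first by rewrite lez_nat hr.1.
apply: (val_ge_trans hv ya); rewrite -sumrB -(mulr1 r%:Z).
under eq_bigr do rewrite -scalerBl ffunE.
exact: val_ge_int_combination.
Qed.

End Qp.

(** * Norms from the unramified quadratic extension *)

Lemma card_image_two_fibers (T U : finType) (h : T -> U) (opp : T -> T) (z : T) :
  opp z = z -> (forall x y, h x = h y -> y = x \/ y = opp x) ->
  (#|T| < 2 * #|h @: T|)%N.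
Proof.
move=> oz fiber.
rewrite -(sum1_card T) (partition_big_imset h) /=.
have hz : h z \in h @: T by rewrite imset_f ?inE.
rewrite (bigD1 (h z)) //= (cardsD1 (h z)) hz mulnDr muln1 add2n ltnS.
have -> : (\sum_(i in T | h i == h z) 1 = 1)%N.
  rewrite (bigD1 z) /= ?inE ?eqxx // big1 // => i /andP[/eqP hi iz].
  by have [e|e] := fiber _ _ (esym hi); rewrite e ?oz eqxx in iz.
rewrite add1n ltnS mulnC -sum_nat_const.
under [X in (_ <= X)%N]eq_bigl do rewrite in_setD1 andbC.
apply: leq_sum => u /andP[/imsetP[x _ ->] _]; rewrite sum1_card.
apply: (@leq_trans #|[set x; opp x]|); last by rewrite cards2; case: (_ != _).
apply/subset_leq_card/fintype.subsetP => y; rewrite unfold_in => /eqP hy.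
by rewrite !inE; have [->|->] := fiber _ _ (esym hy); rewrite eqxx ?orbT.
Qed.

Lemma two_fibers_images_meet (T : finType) (f g opp : T -> T) (z : T) :
  opp z = z -> (forall x y, f x = f y -> y = x \/ y = opp x) ->
  (forall x y, g x = g y -> y = x \/ y = opp x) ->
  exists x y, f x = g y.
Proof.
move=> oz f_fiber g_fiber.
have [disj|/pred0Pn[u /andP[/imsetP[x _ ->] /imsetP[y _ e]]]] :=
    boolP [disjoint f @: T & g @: T]; last by exists x, y.
have := card_image_two_fibers oz f_fiber; have := card_image_two_fibers oz g_fiber.
have : (#|f @: T| + #|g @: T| <= #|T|)%N.
  have /eqP <- : #|f @: T :|: g @: T| == (#|f @: T| + #|g @: T|)%N.
    by rewrite (leq_card_setU _ _).2.
  exact: max_card.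
lia.
Qed.

Section ResidueField.

Variables (k : fieldType) (v : k -> int).
Hypothesis hv : normalized_valuation v.
Hypothesis residue_finite : finite_residues v.

Lemma residue_system : exists (T : finType) (rep : T -> k) (red : k -> T),
  [/\ forall t, val_ge v 0 (rep t),
      forall x, val_ge v 0 x -> val_ge v 1 (x - rep (red x)) &
      forall t t', val_ge v 1 (rep t - rep t') -> t = t'].
Proof.
have [T [rep [rep_int rep_onto]]] := residue_finite.
pose congr t := [pred t' | `[< val_ge v 1 (rep t - rep t') >]].
have congr_refl t : congr t t by apply/asboolP; rewrite subrr; left.
pose canon t := choose (congr t) t.
have canonP t : val_ge v 1 (rep t - rep (canon t)) by apply/asboolP/(chooseP (congr_refl t)).
have canon_eq t t' : val_ge v 1 (rep t - rep t') -> canon t = canon t'.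
  move=> tt'; have /eq_choose same_class : congr t =1 congr t'.
    move=> s; apply: asbool_equiv_eq; split; last exact: (val_ge_trans hv).
    by apply: (val_ge_trans hv); apply: (val_ge_sym hv).
  by rewrite /canon same_class; apply: choose_id => //; apply/asboolP/(val_ge_sym hv).
have canon_fix t : canon (canon t) == canon t.
  exact/eqP/esym/canon_eq.
have [red0 hred0] : exists red0 : k -> T,
    forall x, val_ge v 0 x -> val_ge v 1 (x - rep (red0 x)).
  suff /choice[red0 hred0] x : exists t, val_ge v 0 x -> val_ge v 1 (x - rep t).
    by exists red0.
  have [/rep_onto[t xt]|no] := pselect (val_ge v 0 x); first by exists t.
  by have [t _] := rep_onto 0 (val_ge0 v 0); exists t => /no.
exists {t : T | canon t == t}, (rep \o val), (fun x => exist _ (canon (red0 x)) (canon_fix _)).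
split=> [t|x x_int|t t' /canon_eq tt']; first exact: rep_int.
- exact: (val_ge_trans hv (hred0 x x_int)).
- by apply: val_inj; rewrite -(eqP (valP t)) -(eqP (valP t')).
Qed.

Lemma val_ge1_mulf x y : val_ge v 0 x -> val_ge v 0 y -> val_ge v 1 (x * y) ->
  val_ge v 1 x \/ val_ge v 1 y.
Proof.
move=> hx hy xy; have [x_unit|/(integer_not_unit hx)] := pselect (integer_unit v x); last by left.
by right; rewrite -(subr0 1); apply: (val_ge_mulf_cancel hv) x_unit.1 x_unit.2 xy.
Qed.

(* Both a^2 and c b^2 + u take more than half of the residue classes. *)
Lemma norm_form_onto_residues u c : integer_unit v c -> val_ge v 0 u ->
  exists a b, [/\ val_ge v 0 a, val_ge v 0 b & val_ge v 1 (a ^+ 2 - c * b ^+ 2 - u)].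
Proof.
move=> c_unit u_int; have [T [rep [red [rep_int redP rep_inj]]]] := residue_system.
have red_eq x y : val_ge v 0 x -> val_ge v 0 y -> red x = red y -> val_ge v 1 (x - y).
  move=> /redP hx /redP hy e; rewrite -e in hy.
  exact: (val_ge_trans hv hx (val_ge_sym hv hy)).
have red_rep x t : val_ge v 0 x -> val_ge v 1 (x - rep t) -> red x = t.
  by move=> /redP hx xt; apply/rep_inj/(val_ge_trans hv (val_ge_sym hv hx)).
have sqr_int x : val_ge v 0 x -> val_ge v 0 (x ^+ 2).
  by move=> hx; rewrite expr2; apply: (val_geMl hv).
have c_int := integer_unit_integer c_unit.
have affine_int x : val_ge v 0 x -> val_ge v 0 (c * x ^+ 2 + u).
  by move=> hx; apply: (valD hv) => //; apply: (val_geMl hv) => //; apply: sqr_int.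
pose opp t := red (- rep t).
have sqr_fiber t t' : val_ge v 1 (rep t ^+ 2 - rep t' ^+ 2) -> t' = t \/ t' = opp t.
  rewrite subr_sqr => /val_ge1_mulf[||tt'|tt'].
  - exact: (val_geB hv).
  - exact: (valD hv).
  - by left; apply/esym/rep_inj.
  - right; apply/esym/red_rep; first exact: (val_geN hv).
    by rewrite -opprD; apply: (val_geN hv).
have oz : opp (red 0) = red 0.
  apply: red_rep; first exact: (val_geN hv).
  have z0 : val_ge v 1 (rep (red 0)).
    by rewrite -[rep _]subr0; apply: (val_ge_sym hv); apply: redP; left.
  by apply: (val_geB hv) => //; apply: (val_geN hv).
have [|t t'|t [t']] := two_fibers_images_meet (f := fun t => red (rep t ^+ 2))
    (g := fun t => red (c * rep t ^+ 2 + u)) oz.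
- by move=> t t' /red_eq tt'; apply/sqr_fiber/tt'; apply: sqr_int.
- move=> /red_eq tt'; apply: sqr_fiber; rewrite -(subr0 1).
  apply: (val_ge_mulf_cancel hv) c_unit.1 c_unit.2 _.
  have -> : c * (rep t ^+ 2 - rep t' ^+ 2) = c * rep t ^+ 2 + u - (c * rep t' ^+ 2 + u) by ring.
  by apply: tt'; apply: affine_int.
move=> /red_eq tt'; exists (rep t), (rep t'); split=> //.
by rewrite -addrA -opprD; apply: tt'; [apply: sqr_int|apply: affine_int].
Qed.

End ResidueField.

(* [w] is a uniformizer and [theta] stands for the square root of epsilon. *)
Record unramified_involution (F : fieldType) (sigma : {rmorphism F -> F})
    (v : F -> int) (w theta : F) : Prop := {
  uinv_pchar : [pchar F] =i pred0;
  uinv_valuation : normalized_valuation v;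
  uinv_involutive : involutive sigma;
  uinv_val : forall x, v (sigma x) = v x;
  uinv_prime : prime_element v w;
  uinv_fixed_prime : sigma w = w;
  uinv_theta : sigma theta = - theta;
  uinv_one_add_theta : 1 + theta != 0 /\ v (1 + theta) = v 2%:R;
  uinv_norm_unit : forall u, integer_unit v u -> sigma u = u ->
    exists2 z, integer_unit v z & z * sigma z = u;
  uinv_norm_near1 : forall (N : int) u, 0 < N -> sigma u = u -> val_ge v N (u - 1) ->
    exists2 y, val_ge v N (y - 1) & y * sigma y = u }.

Lemma fieldExt_pchar0 (k : fieldType) (L : fieldExtType k) :
  [pchar k] =i pred0 -> [pchar L] =i pred0.
Proof. by move=> k_pchar q; rewrite (fmorph_pchar (in_alg L)). Qed.

Section UnramifiedQuadratic.

Variables (k : fieldType) (v : k -> int).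
Hypotheses (hv : normalized_valuation v) (k_complete : series_complete v).
Hypothesis residue_finite : finite_residues v.
Hypothesis k_pchar : [pchar k] =i pred0.
Variables (pi : k) (hpi : prime_element v pi).
Variables (k' : fieldExtType k) (v' : k' -> int) (hv' : normalized_valuation v').
Hypothesis unramified : ramification_index v v' 1.
Variables (sigma : {lrmorphism k' -> k'}) (hsigma : nontrivial_automorphism sigma).
Variables (eps : k) (eps_unit : integer_unit v eps).
Variables (theta : k') (sqr_theta : theta ^+ 2 = eps%:A).
Let omega := (1 + theta) / 2%:R.
Hypothesis hbasis : integral_basis2 v v' 1 omega.

Local Notation norm y := (y * sigma y).

Let two_neq0 : (2%:R : k') != 0.
Proof. by rewrite ((pcharf0P _).1 (fieldExt_pchar0 k' k_pchar)). Qed.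

Lemma in_alg_eq0 (a : k) : (a%:A == 0 :> k') = (a == 0).
Proof. exact: (fmorph_eq0 (in_alg k')). Qed.

Lemma in_algM (a b : k) : (a * b)%:A = a%:A * b%:A :> k'.
Proof. exact: (rmorphM (in_alg k')). Qed.

Lemma val_in_alg (a : k) : a != 0 -> v' a%:A = v a.
Proof. by move=> a0; rewrite (unramified.2 _ a0) mul1r. Qed.

Lemma val_ext_natS n : v' n.+1%:R = v n.+1%:R.
Proof. by rewrite -scaler_nat val_in_alg // ((pcharf0P _).1 k_pchar). Qed.

Lemma val_ge_in_alg N (a : k) : val_ge v N a -> val_ge v' N a%:A.
Proof.
have [->|a0] := eqVneq a 0; first by rewrite scale0r; left.
by move=> /(val_geE a0); right; rewrite val_in_alg.
Qed.

Lemma omega_integer : val_ge v' 0 omega.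
Proof. by case: hbasis => _ []. Qed.

Lemma theta_omega : theta = 2%:R * omega - 1.
Proof. by rewrite mulrC divfK // addrC addKr. Qed.

Lemma integral_coordinates N (x : k') : val_ge v' N x -> exists a b : k,
  [/\ val_ge v N a, val_ge v N b & x = a%:A + b%:A * omega].
Proof.
move=> hx; have [pi0 vpi] := hpi.
have piN0 : pi ^ N != 0 by rewrite expfz_neq0.
have vpiN : v (pi ^ N) = N by rewrite (valXz hv) // vpi mulr1.
have piNA0 : (pi ^ N)%:A != 0 :> k' by rewrite in_alg_eq0.
have y_int : val_ge v' 0 ((pi ^ N)%:A^-1 * x).
  rewrite -(subrr N); apply: (val_ge_mulf_cancel hv' piNA0); first by rewrite val_in_alg.
  by rewrite mulVKf.
have [_ [_ /(_ _ y_int)[[a b] [[/= a_int b_int y_ab] _]]]] := hbasis.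
exists (pi ^ N * a), (pi ^ N * b); split; try exact: (val_geMr hv (val_ge_eq vpiN)).
by rewrite -[x](mulVKf piNA0) y_ab !in_algM -(mulr_algl b omega) mulrDr mulrA.
Qed.

Lemma sigma_theta : sigma theta = - theta.
Proof.
have : sigma theta ^+ 2 = theta ^+ 2 by rewrite -rmorphXn /= sqr_theta rmorph_alg.
move/eqP; rewrite eqf_sqr => /orP[/eqP fixed|/eqP //].
have [_ [x []]] := hsigma.
have [a [b [_ _ ->]]] := integral_coordinates (val_ge_val v' x).
by rewrite rmorphD rmorphM /= !rmorph_alg fmorph_div rmorphD rmorph1 rmorph_nat /= fixed.
Qed.

Lemma sigma_omega : sigma omega = 1 - omega.
Proof.
rewrite fmorph_div rmorphD rmorph1 rmorph_nat /= sigma_theta /omega.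
by field.
Qed.

Lemma sigma_coordinates (a b : k) :
  sigma (a%:A + b%:A * omega) = a%:A + b%:A * (1 - omega).
Proof. by rewrite rmorphD rmorphM /= !rmorph_alg sigma_omega. Qed.

Lemma sigma_involutive : involutive sigma.
Proof.
move=> x; have [a [b [_ _ ->]]] := integral_coordinates (val_ge_val v' x).
rewrite sigma_coordinates rmorphD rmorphM rmorphB rmorph1 /= !rmorph_alg.
by rewrite sigma_omega subKr.
Qed.

Lemma val_ge_sigma N x : val_ge v' N x -> val_ge v' N (sigma x).
Proof.
move=> /integral_coordinates[a [b [ha hb ->]]]; rewrite sigma_coordinates.
apply: (valD hv'); first exact: val_ge_in_alg.
apply: (val_geMr hv'); first exact: val_ge_in_alg.
by apply: (val_geB hv'); [apply: (val_ge_nat hv' 1)|apply: omega_integer].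
Qed.

Lemma val_sigma x : v' (sigma x) = v' x.
Proof.
have [->|x0] := eqVneq x 0; first by rewrite rmorph0.
have sx0 : sigma x != 0 by rewrite fmorph_eq0.
apply/eqP; rewrite eq_le; apply/andP; split; apply: val_geE => //.
  by rewrite -{2}(sigma_involutive x); apply: val_ge_sigma; right.
by apply: val_ge_sigma; right.
Qed.

Lemma integer_unit_norm x : integer_unit v' x -> integer_unit v' (norm x).
Proof.
by move=> [x0 vx]; apply: (integer_unitM hv'); split; rewrite ?fmorph_eq0 ?val_sigma.
Qed.

Lemma sigma_norm x : sigma (norm x) = norm x.
Proof. by rewrite rmorphM /= sigma_involutive mulrC. Qed.

Lemma omega_unit : integer_unit v' omega.
Proof.
apply: contrapT => /(integer_not_unit omega_integer) omega_small.
have : val_ge v' 1 (omega + sigma omega).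
  by apply: (valD hv') => //; apply: val_ge_sigma.
by rewrite sigma_omega addrC subrK => /(val_geE (oner_neq0 _)); rewrite (val1 hv').
Qed.

Lemma one_add_theta : 1 + theta != 0 /\ v' (1 + theta) = v' 2%:R.
Proof.
have [omega0 v_omega] := omega_unit.
have -> : 1 + theta = 2%:R * omega by rewrite theta_omega addrC subrK.
by rewrite mulf_neq0 // (valM hv') // v_omega addr0.
Qed.

Lemma theta_unit : integer_unit v' theta.
Proof.
have theta0 : theta != 0.
  apply/eqP => theta0; move/esym/eqP: sqr_theta; rewrite theta0 expr0n /=.
  by rewrite in_alg_eq0 (negPf eps_unit.1).
split=> //; have := valX hv' 2 theta0.
rewrite sqr_theta (val_in_alg eps_unit.1) eps_unit.2; lia.
Qed.

Lemma sigma_fixed_in_alg N x : sigma x = x -> val_ge v' N x ->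
  exists2 a : k, val_ge v N a & x = a%:A.
Proof.
move=> fixed /integral_coordinates[a [b [ha hb xE]]]; exists a => //.
have : b%:A * theta = 0.
  by rewrite theta_omega -(subrr x) -{2}fixed xE sigma_coordinates; ring.
by move/eqP; rewrite mulf_eq0 (negPf theta_unit.1) orbF xE => /eqP ->; rewrite mul0r addr0.
Qed.

Lemma unramified_complete : series_complete v'.
Proof.
move=> d hd.
have coordinates (n : nat) : exists ab : k * k, [/\ val_ge v n ab.1, val_ge v n ab.2 &
    d n = ab.1%:A + ab.2%:A * omega].
  by have [a [b h]] := integral_coordinates (hd n); exists (a, b).
have [ab hab] := choice coordinates.
have [|la hla] := k_complete (d := fun n => (ab n).1); first by move=> n; have [] := hab n.
have [|lb hlb] := k_complete (d := fun n => (ab n).2); first by move=> n; have [] := hab n.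
exists (la%:A + lb%:A * omega) => n.
have -> : la%:A + lb%:A * omega - \sum_(i < n) d i =
   (la - \sum_(i < n) (ab i).1)%:A + (lb - \sum_(i < n) (ab i).2)%:A * omega.
  have -> : \sum_(i < n) d i = \sum_(i < n) ((ab i).1%:A + (ab i).2%:A * omega).
    by apply: eq_bigr => i _; have [] := hab i.
  by rewrite big_split /= -mulr_suml !scalerBl !scaler_suml; ring.
apply: (valD hv'); first exact: val_ge_in_alg.
by apply: (val_geMr hv') omega_integer; apply: val_ge_in_alg.
Qed.

(* Since omega has trace 1, the norm of 1 + r omega is 1 + r + r^2 N(omega). *)
Lemma norm_correction N u : 0 < N -> sigma u = u -> val_ge v' N (u - 1) ->
  let y := 1 + (u - 1) * omega in
  integer_unit v' y /\ val_ge v' (N + 1) (u / norm y - 1).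
Proof.
move=> N_gt0 fixed; set r := u - 1 => u1 y.
have r_omega : val_ge v' N (r * omega) by apply: (val_geMr hv') u1 omega_integer.
have y_unit : integer_unit v' y.
  by apply: (integer_unit_near hv' N_gt0 (integer_unit1 hv')); rewrite addrC addKr.
split=> //; have norm_unit := integer_unit_norm y_unit.
have -> : u / norm y - 1 = - (r * r * norm omega) / norm y.
  have norm_y : norm y = u + r * r * norm omega.
    rewrite sigma_omega /y /r rmorphD rmorphM rmorphB rmorph1 /= fixed sigma_omega.
    by ring.
  rewrite -[X in _ - X](divff norm_unit.1) -mulrBl; congr (_ / _).
  by rewrite norm_y opprD addNKr.
apply: (val_geMr hv'); last exact/integer_unit_integer/(integer_unitV hv').
apply/(val_geN hv')/(val_geMr hv'); last exact/integer_unit_integer/integer_unit_norm/omega_unit.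
by apply: (@val_ge_le _ _ (N + N)); [lia|apply: (val_geM hv')].
Qed.

Lemma norm_approximations (N : int) u : 0 < N -> sigma u = u -> val_ge v' N (u - 1) ->
  exists z : nat -> k', [/\ z 0%N = 1, forall n, val_ge v' 0 (z n),
    forall n : nat, val_ge v' (N + n) (z n.+1 - z n) &
    forall n : nat, val_ge v' (N + n) (norm (z n) - u)].
Proof.
move=> N_gt0 fixed u1.
pose step t := 1 + (u / norm t - 1) * omega; pose z n := iter n (fun t => t * step t) 1.
have fixed_quotient t : sigma (u / norm t) = u / norm t.
  by rewrite fmorph_div /= sigma_norm fixed.
have z_correct (n : nat) : integer_unit v' (z n) /\ val_ge v' (N + n) (u / norm (z n) - 1).
  elim: n => [|n [z_unit near1]].
    by rewrite /z /= rmorph1 mulr1 divr1 addr0; split=> //; apply: integer_unit1.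
  have [|step_unit] := norm_correction _ (fixed_quotient (z n)) near1; first lia.
  split; first exact: (integer_unitM hv').
  have -> : u / norm (z n.+1) = u / norm (z n) / norm (step (z n)).
    by rewrite /z iterS rmorphM mulrACA invfM mulrA.
  by have -> : N + n.+1%:Z = N + n%:Z + 1 by lia.
have z_int n : val_ge v' 0 (z n) by apply/integer_unit_integer/(z_correct n).1.
exists z; split=> // n; have [z_unit near1] := z_correct n.
  have -> : z n.+1 - z n = z n * ((u / norm (z n) - 1) * omega).
    by rewrite /z iterS mulrDr mulr1 addrAC subrr add0r.
  by apply: (val_geMl hv' (z_int n)); apply: (val_geMr hv') omega_integer.
have norm_z_unit := integer_unit_norm z_unit; apply: (val_ge_sym hv').
rewrite -[X in X - _](divfK norm_z_unit.1 u) -{3}[norm (z n)]mul1r -mulrBl.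
exact: (val_geMr hv' near1) (integer_unit_integer norm_z_unit).
Qed.

Lemma norm_near1 (N : int) u : 0 < N -> sigma u = u -> val_ge v' N (u - 1) ->
  exists2 y, val_ge v' N (y - 1) & norm y = u.
Proof.
move=> N_gt0 fixed u1; have [z [z0 z_int z_cauchy z_norm]] := norm_approximations N_gt0 fixed u1.
have [l hl] := series_complete_shift hv' unramified_complete z_cauchy.
have lim (n : nat) : val_ge v' (N + n) (1 + l - z n).
  have := hl n; rewrite -(big_mkord xpredT (fun i => z i.+1 - z i)) telescope_sumr //.
  by rewrite z0 opprB addrA (addrC l).
have lim1 : val_ge v' N (1 + l - 1) by have := lim 0%N; rewrite z0 addr0.
exists (1 + l) => //; apply/eqP; rewrite -subr_eq0; apply/eqP/(val_ge_all0 (v := v')) => n.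
have l_int : val_ge v' 0 (1 + l).
  rewrite -(subrK 1 (1 + l)); apply: (valD hv'); last exact: (val_ge_nat hv' 1).
  by apply: val_ge_le lim1; lia.
apply: (@val_ge_le _ _ (N + n)); first lia.
have -> : norm (1 + l) - u = (1 + l - z n) * sigma (1 + l)
    + z n * sigma (1 + l - z n) + (norm (z n) - u).
  by rewrite rmorphB /=; ring.
apply: (valD hv') => //; apply: (valD hv').
- by apply: (val_geMr hv') => //; apply: val_ge_sigma.
- by apply: (val_geMl hv') => //; apply: val_ge_sigma.
Qed.

Lemma norm_unit u : integer_unit v' u -> sigma u = u ->
  exists2 z, integer_unit v' z & norm z = u.
Proof.
move=> u_unit fixed.
have [a a_int ua] := sigma_fixed_in_alg fixed (integer_unit_integer u_unit).
have [x [y [x_int y_int xy]]] := norm_form_onto_residues hv residue_finite eps_unit a_int.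
pose z := x%:A + y%:A * theta.
have zu : val_ge v' 1 (norm z - u).
  have -> : norm z - u = (x ^+ 2 - eps * y ^+ 2 - a)%:A.
    rewrite ua !scalerBl !expr2 !in_algM -sqr_theta.
    by rewrite /z rmorphD rmorphM /= !rmorph_alg sigma_theta; ring.
  exact: val_ge_in_alg.
have Nz_unit := integer_unit_near hv' ltr01 u_unit zu.
have [z0 sz0] : z != 0 /\ sigma z != 0.
  by move: Nz_unit.1; rewrite mulf_eq0 negb_or => /andP[].
have z_unit : integer_unit v' z.
  by split=> //; have := Nz_unit.2; rewrite (valM hv') // val_sigma; lia.
have [||t t1 norm_t] := norm_near1 (N := 1) (u := u / norm z) isT.
- by rewrite fmorph_div /= sigma_norm fixed.
- rewrite -[X in _ - X](divff Nz_unit.1) -mulrBl; apply: (val_geMr hv').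
    exact: val_ge_sym.
  exact/integer_unit_integer/(integer_unitV hv').
exists (z * t); last by rewrite rmorphM /= mulrACA norm_t mulrC (divfK Nz_unit.1).
apply: (integer_unitM hv' z_unit).
exact: (integer_unit_near hv' ltr01 (integer_unit1 hv') t1).
Qed.

Lemma unramified_quadratic_involution : unramified_involution sigma v' pi%:A theta.
Proof.
split=> //.
- exact: fieldExt_pchar0.
- exact: sigma_involutive.
- exact: val_sigma.
- by have [pi0 vpi] := hpi; split; rewrite ?in_alg_eq0 ?val_in_alg.
- exact: (rmorph_alg sigma).
- exact: sigma_theta.
- exact: one_add_theta.
- exact: norm_unit.
- exact: norm_near1.
Qed.

End UnramifiedQuadratic.

(** * Hermitian lattices with an involution *)

Lemma idempotent_trace0 (F : fieldType) m (Q : 'M[F]_m) :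
  [pchar F] =i pred0 -> Q *m Q = Q -> \tr Q = 0 -> Q = 0.
Proof.
move=> /pcharf0P ch0 QQ; rewrite -[in \tr Q](mulmx_base Q) mxtrace_mulC.
have -> : row_base Q *m col_base Q = 1%:M.
  apply: (row_full_inj (col_base_full Q)); apply: (row_free_inj (row_base_free Q)).
  by rewrite /= mulmx1 mulmxA mulmx_base -mulmxA mulmx_base QQ.
by move/eqP; rewrite mxtrace1 ch0 mxrank_eq0 => /eqP.
Qed.

Section DiagonalMatrices.

Variable F : fieldType.

Definition fdiag r (f : 'I_r -> F) : 'M[F]_r := diag_mx (\row_a f a).

Lemma fdiagE r (f : 'I_r -> F) a b : fdiag f a b = if a == b then f a else 0.
Proof. by rewrite !mxE; case: eqP. Qed.

Lemma eq_fdiag r (f g : 'I_r -> F) : f =1 g -> fdiag f = fdiag g.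
Proof. by move=> fg; congr diag_mx; apply/rowP => a; rewrite !mxE. Qed.

Lemma fdiagM r (f g : 'I_r -> F) : fdiag f *m fdiag g = fdiag (fun a => f a * g a).
Proof. by rewrite mulmx_diag; congr diag_mx; apply/rowP => a; rewrite !mxE. Qed.

Lemma fdiagD r (f g : 'I_r -> F) : fdiag f + fdiag g = fdiag (fun a => f a + g a).
Proof. by rewrite -raddfD; congr diag_mx; apply/rowP => a; rewrite !mxE. Qed.

Lemma fdiagN r (f : 'I_r -> F) : - fdiag f = fdiag (fun a => - f a).
Proof. by rewrite -raddfN; congr diag_mx; apply/rowP => a; rewrite !mxE. Qed.

Lemma fdiag_scalar r (f : 'I_r -> F) c : (forall a, f a = c) -> fdiag f = c%:M.
Proof. by move=> fc; rewrite -diag_const_mx; congr diag_mx; apply/rowP => a; rewrite !mxE. Qed.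

Lemma fdiag_eq0 r (f : 'I_r -> F) : (forall a, f a = 0) -> fdiag f = 0.
Proof. by move=> /fdiag_scalar ->; rewrite raddf0. Qed.

Lemma fdiag_block r1 r2 (f : 'I_(r1 + r2) -> F) :
  fdiag f = block_mx (fdiag (f \o @lshift r1 r2)) 0 0 (fdiag (f \o @rshift r1 r2)).
Proof.
rewrite -diag_mx_row -[X in _ = diag_mx X]hsubmxK.
by congr (diag_mx _); rewrite -[LHS]hsubmxK row_mxKl row_mxKr; congr row_mx;
  apply/rowP => a; rewrite !mxE.
Qed.

End DiagonalMatrices.

Definition cons_fun (T : Type) r (c : T) (f : 'I_r -> T) (i : 'I_(1 + r)) : T :=
  if fintype.split i is inr j then f j else c.

Lemma cons_funl (T : Type) r (c : T) (f : 'I_r -> T) i : cons_fun c f (lshift r i) = c.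
Proof. by rewrite /cons_fun (unsplitK (inl i)). Qed.

Lemma cons_funr (T : Type) r (c : T) (f : 'I_r -> T) j : cons_fun c f (rshift 1 j) = f j.
Proof. by rewrite /cons_fun (unsplitK (inr j)). Qed.

Lemma cons_fun_all (T : Type) r (P : T -> Prop) (c : T) (f : 'I_r -> T) :
  P c -> (forall i, P (f i)) -> forall i, P (cons_fun c f i).
Proof. by move=> Pc Pf i; rewrite /cons_fun; case: fintype.split. Qed.

Lemma fdiag_cons (T : Type) (F : fieldType) r (g : T -> F) (c : T) (f : 'I_r -> T) :
  fdiag (fun a => g (cons_fun c f a)) = block_mx (g c)%:M 0 0 (fdiag (g \o f)).
Proof.
rewrite fdiag_block; congr (block_mx _ _ _ _).
  by apply: fdiag_scalar => a /=; rewrite cons_funl.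
by apply: eq_fdiag => a /=; rewrite cons_funr.
Qed.

Section IntegralMatrices.

Variables (F : fieldType) (v : F -> int).
Hypothesis hv : normalized_valuation v.

Definition mx_ge m n (N : int) (A : 'M[F]_(m, n)) : Prop :=
  forall i j, val_ge v N (A i j).

Lemma mx_geD m n N (A B : 'M_(m, n)) : mx_ge N A -> mx_ge N B -> mx_ge N (A + B).
Proof. by move=> hA hB i j; rewrite mxE; apply: (valD hv). Qed.

Lemma mx_geB m n N (A B : 'M_(m, n)) : mx_ge N A -> mx_ge N B -> mx_ge N (A - B).
Proof. by move=> hA hB i j; rewrite !mxE; apply: (val_geB hv). Qed.

Lemma mx_geM m n q N M (A : 'M_(m, n)) (B : 'M_(n, q)) :
  mx_ge N A -> mx_ge M B -> mx_ge (N + M) (A *m B).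
Proof.
by move=> hA hB i j; rewrite mxE; apply: (val_ge_sum hv) => l _; apply: (val_geM hv).
Qed.

Lemma mx_geMl m n q N (A : 'M_(m, n)) (B : 'M_(n, q)) :
  mx_ge 0 A -> mx_ge N B -> mx_ge N (A *m B).
Proof. by move=> hA hB; rewrite -(add0r N); apply: mx_geM. Qed.

Lemma mx_geMr m n q N (A : 'M_(m, n)) (B : 'M_(n, q)) :
  mx_ge N A -> mx_ge 0 B -> mx_ge N (A *m B).
Proof. by move=> hA hB; rewrite -(addr0 N); apply: mx_geM. Qed.

Lemma mx_geZ m n N M a (A : 'M_(m, n)) :
  val_ge v N a -> mx_ge M A -> mx_ge (N + M) (a *: A).
Proof. by move=> ha hA i j; rewrite mxE; apply: (val_geM hv). Qed.

Lemma mx_geZl m n N a (A : 'M_(m, n)) :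
  val_ge v 0 a -> mx_ge N A -> mx_ge N (a *: A).
Proof. by move=> ha hA; rewrite -(add0r N); apply: mx_geZ. Qed.

Lemma mx_geZr m n N a (A : 'M_(m, n)) :
  val_ge v N a -> mx_ge 0 A -> mx_ge N (a *: A).
Proof. by move=> ha hA; rewrite -(addr0 N); apply: mx_geZ. Qed.

Lemma mx_ge_scalar m a : val_ge v 0 a -> mx_ge 0 (a%:M : 'M_m).
Proof. by move=> ha i j; rewrite mxE; case: (i == j); rewrite ?mulr1n //; left. Qed.

Lemma mx_ge_row m n1 n2 N (A : 'M_(m, n1)) (B : 'M_(m, n2)) :
  mx_ge N A -> mx_ge N B -> mx_ge N (row_mx A B).
Proof. by move=> hA hB i j; rewrite mxE; case: split_ordP => j' _. Qed.

Lemma mx_ge_fdiag r N (f : 'I_r -> F) : (forall a, val_ge v N (f a)) -> mx_ge N (fdiag f).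
Proof. by move=> hf i j; rewrite fdiagE; case: eqP => // _; left. Qed.

Lemma mx_least_entry m n (A : 'M_(m, n)) : A != 0 ->
  exists i j, A i j != 0 /\ mx_ge (v (A i j)) A.
Proof.
move=> A0; have [ij0 Aij0] : exists ij : 'I_m * 'I_n, A ij.1 ij.2 != 0.
  apply: contrapT => all0; move/eqP: A0; apply; apply/matrixP => i j; rewrite mxE.
  by apply/eqP; apply: contrapT => /negP Aij; apply: all0; exists (i, j).
case: (@arg_minP _ _ _ ij0 (fun ij => A ij.1 ij.2 != 0) (fun ij => v (A ij.1 ij.2)) Aij0).
move=> [i j] /= Aij least; exists i, j; split=> // a b.
by have [->|Aab] := eqVneq (A a b) 0; [left|right; apply: (least (a, b))].
Qed.

End IntegralMatrices.

Section ConjugateTranspose.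

Variables (F : fieldType) (sigma : {rmorphism F -> F}).

Definition ctrmx m n (A : 'M[F]_(m, n)) : 'M[F]_(n, m) := map_mx sigma A^T.

Local Notation "A ^*" := (ctrmx A) : ring_scope.

Lemma ctrmxE m n (A : 'M_(m, n)) i j : A^* i j = sigma (A j i).
Proof. by rewrite !mxE. Qed.

Lemma ctrmxK m n (A : 'M_(m, n)) : involutive sigma -> A^*^* = A.
Proof. by move=> sigmaK; apply/matrixP => i j; rewrite !mxE sigmaK. Qed.

Lemma ctrmxM m n q (A : 'M_(m, n)) (B : 'M_(n, q)) : (A *m B)^* = B^* *m A^*.
Proof. by rewrite /ctrmx trmx_mul map_mxM. Qed.

Lemma ctrmxD m n (A B : 'M_(m, n)) : (A + B)^* = A^* + B^*.
Proof. by rewrite /ctrmx raddfD map_mxD. Qed.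

Lemma ctrmxB m n (A B : 'M_(m, n)) : (A - B)^* = A^* - B^*.
Proof. by rewrite /ctrmx raddfB map_mxB. Qed.

Lemma ctrmxZ m n a (A : 'M_(m, n)) : (a *: A)^* = sigma a *: A^*.
Proof. by apply/matrixP => i j; rewrite !mxE rmorphM. Qed.

Lemma ctrmx0 m n : (0 : 'M_(m, n))^* = 0.
Proof. by rewrite /ctrmx trmx0 map_mx0. Qed.

Lemma ctrmx1 m : (1%:M : 'M_m)^* = 1%:M.
Proof. by rewrite /ctrmx trmx1 map_mx1. Qed.

Lemma ctrmx_scalar m a : (a%:M : 'M_m)^* = (sigma a)%:M.
Proof. by rewrite /ctrmx tr_scalar_mx map_scalar_mx. Qed.

Lemma ctrmx_row m n1 n2 (A : 'M_(m, n1)) (B : 'M_(m, n2)) :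
  (row_mx A B)^* = col_mx A^* B^*.
Proof. by rewrite /ctrmx tr_row_mx map_col_mx. Qed.

Lemma ctrmx_block m1 m2 n1 n2
    (A : 'M_(m1, n1)) (B : 'M_(m1, n2)) (C : 'M_(m2, n1)) (D : 'M_(m2, n2)) :
  (block_mx A B C D)^* = block_mx A^* C^* B^* D^*.
Proof. by rewrite /ctrmx tr_block_mx map_block_mx. Qed.

Lemma ctrmx_fdiag r (f : 'I_r -> F) : (fdiag f)^* = fdiag (sigma \o f).
Proof.
by apply/matrixP => a b; rewrite ctrmxE !fdiagE eq_sym; case: eqP => [->|]; rewrite ?rmorph0.
Qed.

Definition gram m (D : 'M[F]_m) p q (X : 'M[F]_(m, p)) (Y : 'M[F]_(m, q)) : 'M[F]_(p, q) :=
  X^* *m D *m Y.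

Definition hform m (D : 'M[F]_m) (x y : 'cV[F]_m) : F := gram D x y 0 0.

Section Forms.

Variables (m : nat) (D : 'M[F]_m).

Lemma gramC p q (X : 'M_(m, p)) (Y : 'M_(m, q)) :
  involutive sigma -> D^* = D -> (gram D X Y)^* = gram D Y X.
Proof. by move=> sigmaK hD; rewrite /gram !ctrmxM ctrmxK // hD mulmxA. Qed.

Lemma gram_row p1 p2 q1 q2
    (X1 : 'M_(m, p1)) (X2 : 'M_(m, p2)) (Y1 : 'M_(m, q1)) (Y2 : 'M_(m, q2)) :
  gram D (row_mx X1 X2) (row_mx Y1 Y2) =
  block_mx (gram D X1 Y1) (gram D X1 Y2) (gram D X2 Y1) (gram D X2 Y2).
Proof. by rewrite /gram ctrmx_row mul_col_mx mul_col_row. Qed.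

Lemma gram_rowr p q1 q2 (X : 'M_(m, p)) (Y1 : 'M_(m, q1)) (Y2 : 'M_(m, q2)) :
  gram D X (row_mx Y1 Y2) = row_mx (gram D X Y1) (gram D X Y2).
Proof. by rewrite /gram mul_mx_row. Qed.

Lemma gram_rowl p1 p2 q (X1 : 'M_(m, p1)) (X2 : 'M_(m, p2)) (Y : 'M_(m, q)) :
  gram D (row_mx X1 X2) Y = col_mx (gram D X1 Y) (gram D X2 Y).
Proof. by rewrite /gram ctrmx_row !mul_col_mx. Qed.

Lemma gramDr p q (X : 'M_(m, p)) (Y Z : 'M_(m, q)) :
  gram D X (Y + Z) = gram D X Y + gram D X Z.
Proof. exact: mulmxDr. Qed.

Lemma gramDl p q (X Y : 'M_(m, p)) (Z : 'M_(m, q)) :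
  gram D (X + Y) Z = gram D X Z + gram D Y Z.
Proof. by rewrite /gram ctrmxD !mulmxDl. Qed.

Lemma gram_mulr p q r (X : 'M_(m, p)) (Y : 'M_(m, q)) (A : 'M_(q, r)) :
  gram D X (Y *m A) = gram D X Y *m A.
Proof. exact: mulmxA. Qed.

Lemma gram_mull p q r (X : 'M_(m, p)) (Y : 'M_(m, q)) (A : 'M_(p, r)) :
  gram D (X *m A) Y = A^* *m gram D X Y.
Proof. by rewrite /gram ctrmxM !mulmxA. Qed.

Lemma gram_cV (x y : 'cV_m) : gram D x y = (hform D x y)%:M.
Proof. exact: mx11_scalar. Qed.

Lemma hformDr x y z : hform D x (y + z) = hform D x y + hform D x z.
Proof. by rewrite /hform gramDr mxE. Qed.

Lemma hformDl x y z : hform D (x + y) z = hform D x z + hform D y z.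
Proof. by rewrite /hform gramDl mxE. Qed.

Lemma hformZr a x y : hform D x (a *: y) = a * hform D x y.
Proof. by rewrite /hform /gram -scalemxAr mxE. Qed.

Lemma hformZl a x y : hform D (a *: x) y = sigma a * hform D x y.
Proof. by rewrite /hform /gram ctrmxZ -!scalemxAl mxE. Qed.

Lemma hformNr x y : hform D x (- y) = - hform D x y.
Proof. by rewrite -scaleN1r hformZr mulN1r. Qed.

Lemma hformBr x y z : hform D x (y - z) = hform D x y - hform D x z.
Proof. by rewrite hformDr hformNr. Qed.

Lemma hform_delta i j : hform D (delta_mx i 0) (delta_mx j 0) = D i j.
Proof. by rewrite /hform /gram /ctrmx trmx_delta map_delta_mx -rowE -colE !mxE. Qed.

Lemma hformC x y : involutive sigma -> D^* = D -> hform D y x = sigma (hform D x y).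
Proof. by move=> sigmaK hD; rewrite /hform -(gramC x y) // ctrmxE. Qed.

Lemma outer_mulmx (x y z : 'cV_m) : x *m y^* *m D *m z = hform D y z *: x.
Proof.
by rewrite -!mulmxA (mulmxA (y^*)) [X in x *m X]mx11_scalar mul_mx_scalar.
Qed.

Lemma mxtrace_outer (x y : 'cV_m) : \tr (x *m y^* *m D) = hform D y x.
Proof. by rewrite -mulmxA mxtrace_mulC /mxtrace big_ord1. Qed.

End Forms.

End ConjugateTranspose.

Section HermitianLattices.

Variables (F : fieldType) (sigma : {rmorphism F -> F}) (v : F -> int) (w theta : F).
Hypothesis U : unramified_involution sigma v w theta.

Let hv := uinv_valuation U.
Let sigmaK := uinv_involutive U.

Local Notation "A ^*" := (ctrmx sigma A) : ring_scope.
Local Notation mxge := (mx_ge v).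

Let two_neq0 : (2%:R : F) != 0.
Proof. by rewrite ((pcharf0P _).1 (uinv_pchar U)). Qed.

Lemma val_ge_uinv N x : val_ge v N x -> val_ge v N (sigma x).
Proof. by move=> [->|h]; [left; rewrite rmorph0|right; rewrite (uinv_val U)]. Qed.

Lemma mx_ge_ctrmx m n N (A : 'M_(m, n)) : mxge N A -> mxge N A^*.
Proof. by move=> hA i j; rewrite ctrmxE; apply: val_ge_uinv. Qed.

Lemma hform_ge m N M (D : 'M_m) x y :
  mxge 0 D -> mxge N x -> mxge M y -> val_ge v (N + M) (hform sigma D x y).
Proof.
by move=> hD hx hy; apply: (mx_geM hv) => //; apply: (mx_geMr hv) => //; apply: mx_ge_ctrmx.
Qed.

Lemma exprz_prime_neq0 (N : int) : w ^ N != 0.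
Proof. by rewrite expfz_neq0 // (uinv_prime U).1. Qed.

Lemma val_exprz_prime (N : int) : v (w ^ N) = N.
Proof. by have [w0 vw] := uinv_prime U; rewrite (valXz hv) // vw mulr1. Qed.

Lemma val_ge_exprz_prime (N : int) : val_ge v N (w ^ N).
Proof. exact/val_ge_eq/val_exprz_prime. Qed.

Lemma sigma_exprz_prime (N : int) : sigma (w ^ N) = w ^ N.
Proof. by rewrite fmorphXz (uinv_fixed_prime U). Qed.

Lemma exprz_primeD (N M : int) : w ^ (N + M) = w ^ N * w ^ M.
Proof. by rewrite expfzDr // (uinv_prime U).1. Qed.

Lemma exprz_primeNK (N : int) : w ^ N * w ^ (- N) = 1.
Proof. by rewrite -exprz_primeD subrr. Qed.

Lemma trace_one_integer : exists2 omega, val_ge v 0 omega & omega + sigma omega = 1.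
Proof.
have [theta1 v_theta1] := uinv_one_add_theta U.
exists ((1 + theta) / 2%:R).
  by right; rewrite (val_div hv) // v_theta1 subrr.
by rewrite fmorph_div rmorphD rmorph1 rmorph_nat (uinv_theta U); field.
Qed.

Lemma norm_exprz_prime d : d != 0 -> sigma d = d ->
  exists2 z, integer_unit v z & z * sigma z * d = w ^ v d.
Proof.
move=> d0 sd; have [||z z_unit zz] := uinv_norm_unit U (u := w ^ v d / d).
- by apply: (integer_unit_div hv) => //; rewrite ?exprz_prime_neq0 ?val_exprz_prime.
- by rewrite fmorph_div sigma_exprz_prime sd.
by exists z => //; rewrite zz divfK.
Qed.

Lemma norm_opp_exprz_prime d : d != 0 -> sigma d = d ->
  exists2 z, integer_unit v z & z * sigma z * d = - w ^ v d.
Proof.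
move=> d0 sd; have [||z z_unit zd] := norm_exprz_prime (d := - d).
- by rewrite oppr_eq0.
- by rewrite rmorphN sd.
by exists z => //; rewrite -[d in LHS]opprK mulrN zd (valN hv).
Qed.

Lemma hermitian_attains_scale m (D : 'M[F]_m) : D^* = D -> D != 0 ->
  exists y : 'cV_m, let d := hform sigma D y y in
    [/\ mxge 0 y, d != 0 & mxge (v d) D].
Proof.
move=> hD /(mx_least_entry v)[i [j [Dij D_ge]]]; set l := v (D i j) in D_ge.
have delta_int a : mxge 0 (delta_mx a 0 : 'cV[F]_m).
  by move=> b c; rewrite mxE; apply: (val_ge_nat hv).
have [[a [Daa vDaa]]|no_diag] := pselect (exists a, D a a != 0 /\ v (D a a) = l).
  by exists (delta_mx a 0); rewrite /= hform_delta vDaa.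
have diag_ge a : val_ge v (l + 1) (D a a).
  have [->|Daa] := eqVneq (D a a) 0; [by left|right].
  have := val_geE Daa (D_ge a a).
  have : v (D a a) <> l by move=> e; apply: no_diag; exists a.
  lia.
have [omega omega_int omega_tr] := trace_one_integer.
pose z := omega * (w ^ l / D i j).
have z_int : val_ge v 0 z.
  apply: (val_geMl hv) => //; right.
  by rewrite (val_div hv) ?exprz_prime_neq0 // val_exprz_prime subrr.
pose y : 'cV[F]_m := delta_mx i 0 + z *: delta_mx j 0.
have Dy : hform sigma D y y = w ^ l + (D i i + sigma z * z * D j j).
  rewrite !(hformDl, hformDr, hformZl, hformZr) !hform_delta.
  have zD : z * D i j = omega * w ^ l by rewrite -mulrA divfK.
  have szD : sigma z * D j i = sigma omega * w ^ l.
    by rewrite -{1}hD ctrmxE -rmorphM /= zD rmorphM sigma_exprz_prime.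
  have <- : z * D i j + sigma z * D j i = w ^ l by rewrite zD szD -mulrDl omega_tr mul1r.
  ring.
have [|d0 vd] := valD_lt hv (y := D i i + sigma z * z * D j j) (exprz_prime_neq0 l).
  rewrite val_exprz_prime; apply: (valD hv) => //.
  by apply: (val_geMl hv) => //; apply: (val_geMl hv) => //; apply: val_ge_uinv.
exists y; rewrite /= Dy vd val_exprz_prime; split=> //.
by apply: (mx_geD hv) => //; apply: (mx_geZl hv).
Qed.

Variables (m : nat) (J : 'M[F]_m).
Hypotheses (JJ : J *m J = 1%:M) (J_herm : J^* = J) (J_int : mxge 0 J).

Local Notation h := (hform sigma J).

Definition selfadjoint (A : 'M[F]_m) : Prop := A^* *m J = J *m A.

Lemma gram_selfadjoint A p q (X : 'M_(m, p)) (Y : 'M_(m, q)) :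
  selfadjoint A -> gram sigma J (A *m X) Y = gram sigma J X (A *m Y).
Proof. by move=> hA; rewrite /gram ctrmxM -!mulmxA [A^* *m _]mulmxA hA !mulmxA. Qed.

Lemma hform_selfadjoint A x y : selfadjoint A -> h (A *m x) y = h x (A *m y).
Proof. by move=> hA; rewrite /hform gram_selfadjoint. Qed.

Lemma selfadjoint_form_fixed A x : selfadjoint A -> sigma (h x (A *m x)) = h x (A *m x).
Proof. by move=> hA; rewrite -hformC // hform_selfadjoint. Qed.

Lemma selfadjoint1 : selfadjoint 1%:M.
Proof. by rewrite /selfadjoint ctrmx1 mul1mx mulmx1. Qed.

Lemma selfadjointB A B : selfadjoint A -> selfadjoint B -> selfadjoint (A - B).
Proof. by move=> hA hB; rewrite /selfadjoint ctrmxB mulmxBl mulmxBr hA hB. Qed.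

Lemma selfadjoint_mulJ S : S^* = S -> selfadjoint (S *m J).
Proof. by move=> hS; rewrite /selfadjoint ctrmxM hS J_herm mulmxA. Qed.

Lemma selfadjoint_comm A B : selfadjoint A -> selfadjoint B -> selfadjoint (A *m B) ->
  A *m B = B *m A.
Proof.
move=> hA hB hAB; rewrite -[LHS]mul1mx -[RHS]mul1mx -JJ -!mulmxA; congr (J *m _).
by rewrite -hAB ctrmxM -mulmxA hA !mulmxA hB.
Qed.

Record lattice_involution (s : 'M[F]_m) : Prop := {
  linv_sqr : s *m s = 1%:M;
  linv_adj : selfadjoint s }.

Lemma lattice_involutionN s : lattice_involution s -> lattice_involution (- s).
Proof.
move=> [ss sJ]; split; first by rewrite mulmxN mulNmx opprK.
by rewrite -[- s]add0r; apply: selfadjointB => //; rewrite /selfadjoint ctrmx0 mul0mx mulmx0.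
Qed.

Lemma involution_sub_selfadjoint s : lattice_involution s -> selfadjoint (1%:M - s).
Proof. by move=> s_inv; apply: selfadjointB (linv_adj s_inv); apply: selfadjoint1. Qed.

Record stable_projection (s P : 'M[F]_m) : Prop := {
  sproj_idem : P *m P = P;
  sproj_adj : selfadjoint P;
  sproj_comm : s *m P = P *m s;
  sproj_int : mxge 0 P }.

Lemma stable_projection1 s : stable_projection s 1%:M.
Proof.
split; rewrite ?mulmx1 ?mul1mx //; first exact: selfadjoint1.
by apply: mx_ge_scalar; apply: (val_ge_nat hv 1).
Qed.

Lemma stable_projectionN s P : stable_projection s P -> stable_projection (- s) P.
Proof. by move=> [PP PJ sP P_int]; split; rewrite // mulNmx mulmxN sP. Qed.

Lemma stable_projectionB s P Q : stable_projection s P -> stable_projection s Q ->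
  P *m Q = Q -> stable_projection s (P - Q).
Proof.
move=> hP hQ PQ.
have QP : Q *m P = Q.
  by rewrite -selfadjoint_comm ?PQ; [|exact: sproj_adj hP|exact: sproj_adj hQ|exact: sproj_adj hQ].
split.
- by rewrite mulmxBl !mulmxBr (sproj_idem hP) (sproj_idem hQ) PQ QP subrr subr0.
- by apply: selfadjointB; [exact: sproj_adj hP|exact: sproj_adj hQ].
- by rewrite mulmxBl mulmxBr (sproj_comm hP) (sproj_comm hQ).
- by apply: (mx_geB hv); [exact: sproj_int hP|exact: sproj_int hQ].
Qed.

Lemma stable_projection_image s P q (E : 'M_(m, q)) : stable_projection s P ->
  P *m E = E -> P *m (s *m E) = s *m E.
Proof. by move=> hP PE; rewrite mulmxA -(sproj_comm hP) -mulmxA PE. Qed.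

(* The hermitian form (y, z) |-> h y ((1 - s) z) on the image of P takes at y a
   value of the least possible valuation. *)
Record attains_scale (s P : 'M[F]_m) (y : 'cV[F]_m) : Prop := {
  scale_int : mxge 0 y;
  scale_image : P *m y = y;
  scale_neq0 : h y ((1%:M - s) *m y) != 0;
  scale_ge : mxge (v (h y ((1%:M - s) *m y))) ((1%:M - s) *m P) }.

Section Scale.

Variables (s P : 'M[F]_m).
Hypotheses (s_inv : lattice_involution s) (P_proj : stable_projection s P).

Let ss := linv_sqr s_inv.
Let s1 := 1%:M - s.

Let s1_adj : selfadjoint s1 := involution_sub_selfadjoint s_inv.

Let s1P : s1 *m P = P *m s1.
Proof. by rewrite mulmxBl mulmxBr mul1mx mulmx1 (sproj_comm P_proj). Qed.

Lemma involution_sub_sqr : s1 *m s1 = 2%:R *: s1.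
Proof.
rewrite mulmxBl !mulmxBr ss !mulmx1 !mul1mx opprB.
by rewrite scaler_nat mulr2n addrA addrAC.
Qed.

Lemma involution_sub_anti q (y : 'M_(m, q)) : s *m (s1 *m y) = - (s1 *m y).
Proof. by rewrite mulmxA mulmxBr mulmx1 ss -opprB mulNmx. Qed.

Lemma involution_sub_image q (y : 'M_(m, q)) : P *m y = y -> P *m (s1 *m y) = s1 *m y.
Proof. by move=> Py; rewrite mulmxA -s1P -mulmxA Py. Qed.

Lemma involution_sub_ge q N (y : 'M_(m, q)) : mxge N (s1 *m P) -> mxge 0 y -> P *m y = y ->
  mxge N (s1 *m y).
Proof. by move=> hN hy <-; rewrite mulmxA; apply: (mx_geMr hv). Qed.

Lemma hform_involution_sub y : h (s1 *m y) (s1 *m y) = 2%:R * h y (s1 *m y).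
Proof. by rewrite hform_selfadjoint // mulmxA involution_sub_sqr -scalemxAl hformZr. Qed.

Lemma attains_scale_max N y : attains_scale s P y -> mxge N (s1 *m P) ->
  N <= v (h y (s1 *m y)).
Proof.
move=> y_att hN; apply: val_geE (scale_neq0 y_att) _; rewrite -(add0r N).
apply: hform_ge (scale_int y_att) _ => //.
exact: involution_sub_ge hN (scale_int y_att) (scale_image y_att).
Qed.

(* 1 - s acts as 2 on its image. *)
Lemma attains_scale_le y : attains_scale s P y -> v (h y (s1 *m y)) <= v 2%:R.
Proof.
move=> y_att; set l := v _.
have W_ge := involution_sub_ge (scale_ge y_att) (scale_int y_att) (scale_image y_att).
have := hform_ge J_int W_ge W_ge; rewrite -/l hform_involution_sub.
move=> /(val_geE (mulf_neq0 two_neq0 (scale_neq0 y_att))).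
by rewrite (valM hv) // ?(scale_neq0 y_att) // -/l; lia.
Qed.

Lemma attains_scale_exists : s1 *m P != 0 -> exists y, attains_scale s P y.
Proof.
move=> s1P_neq0; have [||y0 /= [y0_int d0 D_ge]] := @hermitian_attains_scale m (J *m (s1 *m P)).
- rewrite ctrmxM J_herm ctrmxM -mulmxA s1_adj mulmxA (sproj_adj P_proj).
  by rewrite -mulmxA -s1P.
- by apply: contra_neq s1P_neq0 => D0; rewrite -[LHS]mul1mx -JJ -mulmxA D0 mulmx0.
have valueE : h (P *m y0) (s1 *m (P *m y0)) = hform sigma (J *m (s1 *m P)) y0 y0.
  rewrite hform_selfadjoint; last exact: sproj_adj P_proj.
  have PsP : P *m (s1 *m P) = s1 *m P by rewrite mulmxA -s1P -mulmxA (sproj_idem P_proj).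
  by rewrite (mulmxA s1) (mulmxA P) PsP /hform /gram !mulmxA.
exists (P *m y0); split; rewrite ?valueE //.
- by apply: (mx_geMr hv) => //; apply: sproj_int P_proj.
- by rewrite mulmxA (sproj_idem P_proj).
- by have := mx_geMl hv J_int D_ge; rewrite (mulmxA J J) JJ mul1mx.
Qed.

End Scale.

Record hyperbolic_vector (s P : 'M[F]_m) (l : int) (x : 'cV[F]_m) : Prop := {
  hyp_int : mxge 0 x;
  hyp_image : P *m x = x;
  hyp_isotropic : h x x = 0;
  hyp_pairing : h x (s *m x) = w ^ l;
  hyp_ge : mxge l ((1%:M - s) *m P) }.

Lemma hyperbolic_value s P l x : hyperbolic_vector s P l x ->
  h x ((1%:M - s) *m x) = - w ^ l.
Proof.
move=> x_hyp; rewrite mulmxBl mul1mx hformBr (hyp_isotropic x_hyp) (hyp_pairing x_hyp).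
exact: sub0r.
Qed.

Lemma val_hyperbolic_value s P l x : hyperbolic_vector s P l x ->
  v (h x ((1%:M - s) *m x)) = l.
Proof. by move=> x_hyp; rewrite (hyperbolic_value x_hyp) (valN hv) val_exprz_prime. Qed.

Lemma hyperbolic_attains s P l x : hyperbolic_vector s P l x -> attains_scale s P x.
Proof.
move=> x_hyp; have val_l := val_hyperbolic_value x_hyp.
case: (x_hyp) => x_int Px _ _ P_ge; split; rewrite ?val_l //.
by rewrite (hyperbolic_value x_hyp) oppr_eq0 exprz_prime_neq0.
Qed.

Lemma hyperbolic_le s P l x : lattice_involution s -> hyperbolic_vector s P l x -> l <= v 2%:R.
Proof.
move=> s_inv x_hyp; have := attains_scale_le s_inv (hyperbolic_attains x_hyp).
by rewrite (val_hyperbolic_value x_hyp).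
Qed.

Lemma hyperbolic_max s P l x N : hyperbolic_vector s P l x ->
  mxge N ((1%:M - s) *m P) -> N <= l.
Proof.
move=> x_hyp P_ge; have := attains_scale_max (hyperbolic_attains x_hyp) P_ge.
by rewrite (val_hyperbolic_value x_hyp).
Qed.

Section Plane.

Variables (s : 'M[F]_m) (y : 'cV[F]_m) (alpha beta : F).
Hypothesis s_inv : lattice_involution s.
Let s1 := 1%:M - s.
Let x := alpha *: y + beta *: (s1 *m y).
Local Notation norm z := (z * sigma z).

Let s1_adj : selfadjoint s1 := involution_sub_selfadjoint s_inv.

Let value_anti : h (s1 *m y) y = h y (s1 *m y).
Proof. exact: hform_selfadjoint. Qed.

Lemma plane_square : 2%:R * h x x =
  norm alpha * (2%:R * h y y - h y (s1 *m y)) + norm (alpha + 2%:R * beta) * h y (s1 *m y).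
Proof.
rewrite !(hformDl, hformDr, hformZl, hformZr) hform_involution_sub // value_anti.
by rewrite rmorphD rmorphM rmorph_nat; ring.
Qed.

Lemma plane_pairing :
  h x (s *m x) = h x x - norm (alpha + 2%:R * beta) * h y (s1 *m y).
Proof.
have -> : s *m x = x - (alpha + 2%:R * beta) *: (s1 *m y).
  have -> : s *m x = x - s1 *m x by rewrite mulmxBl mul1mx subKr.
  congr (_ - _); rewrite mulmxDr -!scalemxAr mulmxA (involution_sub_sqr s_inv).
  by rewrite -scalemxAl scalerA mulrC -scalerDl.
rewrite hformBr hformZr; have -> : h x (s1 *m y) = sigma (alpha + 2%:R * beta) * h y (s1 *m y).
  rewrite hformDl !hformZl (hform_involution_sub s_inv).
  by rewrite rmorphD rmorphM rmorph_nat; ring.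
by rewrite mulrA.
Qed.

End Plane.

Lemma hyperbolic_of_small_scale s P y : lattice_involution s -> stable_projection s P ->
  attains_scale s P y -> v (h y ((1%:M - s) *m y)) < v 2%:R ->
  exists x, hyperbolic_vector s P (v (h y ((1%:M - s) *m y))) x.
Proof.
move=> s_inv P_proj y_att; have [y_int Py d0 P_ge] := y_att.
set d := h y _ in d0 P_ge *; set l := v d in P_ge * => l_small.
have sd : sigma d = d by apply/selfadjoint_form_fixed/involution_sub_selfadjoint.
have [z z_unit zd] := norm_opp_exprz_prime d0 sd.
pose a := h y y.
have a_int : val_ge v 0 a by have := hform_ge J_int y_int y_int.
have [|||t t1 norm_t] := uinv_norm_near1 U (N := v 2%:R - l) (u := 1 - 2%:R * a / d).
- by rewrite subr_gt0.
- by rewrite rmorphB rmorph1 fmorph_div rmorphM rmorph_nat /= sd -hformC.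
- rewrite addrAC subrr add0r; apply: (val_geN hv); apply: (val_geM hv).
    by apply: (val_geMr hv) => //; right.
  by right; rewrite (valV hv).
have t_unit : integer_unit v t.
  by apply: (integer_unit_near hv _ (integer_unit1 hv) t1); rewrite subr_gt0.
pose alpha := z / t; pose beta := (z - alpha) / 2%:R.
have alpha_int : val_ge v 0 alpha.
  exact/integer_unit_integer/(integer_unitM hv)/(integer_unitV hv).
have zE : alpha + 2%:R * beta = z by rewrite /beta; field.
have beta_ge : val_ge v (- l) beta.
  have -> : - l = v 2%:R - l - v 2%:R by lia.
  apply: (val_ge_mulf_cancel hv two_neq0) => //.
  have -> : 2%:R * beta = alpha * (t - 1).
    by rewrite /beta /alpha; field; rewrite t_unit.1.
  exact: (val_geMl hv).
pose x := alpha *: y + beta *: ((1%:M - s) *m y); have isotropic : h x x = 0.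
  apply: (mulfI two_neq0); rewrite mulr0 plane_square // zE -/d -/a.
  have -> : alpha * sigma alpha * (2%:R * a - d) = - (z * sigma z * d).
    have -> : 2%:R * a - d = - (t * sigma t * d).
      by rewrite norm_t mulrBl mul1r divfK // opprB.
    rewrite /alpha fmorph_div; field.
    by rewrite t_unit.1 fmorph_eq0 t_unit.1.
  exact: addNr.
exists x; split=> //.
- apply: (mx_geD hv); first exact: (mx_geZl hv).
  by rewrite -(addNr l); apply: (mx_geZ hv) => //; apply: involution_sub_ge Py.
- by rewrite mulmxDr -!scalemxAr Py (involution_sub_image P_proj Py).
- by rewrite plane_pairing // isotropic zE zd sub0r opprK.
Qed.

(* Here the lattice splits into the eigenlattices of s, and x is half the sum of
   vectors W, W1 of opposite norms in them. *)
Lemma hyperbolic_of_full_scale s P y y1 :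
  lattice_involution s -> stable_projection s P ->
  attains_scale s P y -> v (h y ((1%:M - s) *m y)) = v 2%:R ->
  attains_scale (- s) P y1 -> v (h y1 ((1%:M - - s) *m y1)) = v 2%:R ->
  exists x, hyperbolic_vector s P (v 2%:R) x.
Proof.
move=> s_inv P_proj y_att vd y1_att vd1; set l := v 2%:R in vd vd1 *.
have [sN_inv PN_proj] := (lattice_involutionN s_inv, stable_projectionN P_proj).
have [s1_adj sN1_adj] := (involution_sub_selfadjoint s_inv, involution_sub_selfadjoint sN_inv).
have [sd sd1] := (selfadjoint_form_fixed y s1_adj, selfadjoint_form_fixed y1 sN1_adj).
have [[y_int Py d0 P_ge] [y1_int Py1 d10 P1_ge]] := (y_att, y1_att).
set W := _ *m y in vd d0 P_ge sd; set W1 := _ *m y1 in vd1 d10 P1_ge sd1.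
rewrite vd in P_ge; rewrite vd1 in P1_ge.
have W_ge : mxge l W := involution_sub_ge P_ge y_int Py.
have W1_ge : mxge l W1 := involution_sub_ge P1_ge y1_int Py1.
have PW : P *m W = W := involution_sub_image P_proj Py.
have PW1 : P *m W1 = W1 := involution_sub_image PN_proj Py1.
have sW : s *m W = - W := involution_sub_anti s_inv y.
have sW1 : s *m W1 = W1.
  by have /eqP := involution_sub_anti sN_inv y1; rewrite mulNmx eqr_opp => /eqP.
have WW : h W W = 2%:R * h y W := hform_involution_sub s_inv y.
have W1W1 : h W1 W1 = 2%:R * h y1 W1 := hform_involution_sub sN_inv y1.
have WW1 : h W W1 = 0.
  by rewrite hform_selfadjoint // mulmxBl mul1mx sW1 subrr -(scale0r 0) hformZr mul0r.
have W1W : h W1 W = 0 by rewrite hformC // WW1 rmorph0.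
clearbody W W1.
have [z z_unit zd] := norm_opp_exprz_prime d0 sd.
have [z1 z1_unit zd1] := norm_exprz_prime d10 sd1.
rewrite vd in zd; rewrite vd1 in zd1.
have s2 : sigma 2%:R^-1 = 2%:R^-1 by rewrite fmorphV rmorph_nat.
exists (2%:R^-1 *: (z *: W + z1 *: W1)); split.
- rewrite -(addNr l); apply: (mx_geZ hv); first by right; rewrite (valV hv).
  by apply: (mx_geD hv); apply: (mx_geZl hv) => //; apply: integer_unit_integer.
- by rewrite -scalemxAr mulmxDr -!scalemxAr PW PW1.
- rewrite !(hformDl, hformDr, hformZl, hformZr) WW WW1 W1W W1W1 s2.
  transitivity (2%:R^-1 * 2%:R^-1 * 2%:R *
    (z * sigma z * h y W + z1 * sigma z1 * h y1 W1)); first by ring.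
  by rewrite zd zd1 addNr mulr0.
- rewrite -!scalemxAr mulmxDr -!scalemxAr sW sW1 scalerN.
  rewrite !(hformDl, hformDr, hformZl, hformZr, hformNr) WW WW1 W1W W1W1 s2.
  transitivity (2%:R^-1 * 2%:R^-1 * 2%:R *
    (z1 * sigma z1 * h y1 W1 - z * sigma z * h y W)); first by ring.
  by rewrite zd zd1; field.
- exact: P_ge.
Qed.

Lemma hyperbolic_exists s P : lattice_involution s -> stable_projection s P ->
  (1%:M - s) *m P != 0 -> (1%:M + s) *m P != 0 ->
  exists l x, hyperbolic_vector s P l x.
Proof.
move=> s_inv P_proj sub0 add0.
have [y y_att] := attains_scale_exists s_inv P_proj sub0.
have := attains_scale_le s_inv y_att; rewrite le_eqVlt => /orP[/eqP full|small].
  have [sN_inv PN_proj] := (lattice_involutionN s_inv, stable_projectionN P_proj).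
  have [|y1 y1_att] := attains_scale_exists sN_inv PN_proj; first by rewrite opprK.
  have [|x x_hyp] := hyperbolic_of_full_scale s_inv P_proj y_att full y1_att;
    last by exists (v 2%:R), x.
  apply/eqP; rewrite eq_le (attains_scale_le sN_inv y1_att) /=.
  apply: attains_scale_max y1_att _ => //.
  have -> : (1%:M - - s) *m P = 2%:R *: P - (1%:M - s) *m P.
    by rewrite opprK mulmxDl mulmxBl !mul1mx scaler_nat mulr2n opprB addrA addrAC addrK.
  apply: (mx_geB hv); first by apply: (mx_geZr hv (val_ge_val v _)); apply: sproj_int P_proj.
  by rewrite -full; apply: scale_ge y_att.
have [x x_hyp] := hyperbolic_of_small_scale s_inv P_proj y_att small.
by eexists; exists x; apply: x_hyp.
Qed.

Section HyperbolicPlane.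

Variables (s P : 'M[F]_m) (l : int) (x : 'cV[F]_m).
Hypotheses (s_inv : lattice_involution s) (P_proj : stable_projection s P).
Hypothesis x_hyp : hyperbolic_vector s P l x.

Let ss := linv_sqr s_inv.
Let sx := s *m x.

(* The orthogonal projection onto the plane spanned by x and s x. *)
Definition hyperbolic_projection : 'M[F]_m :=
  w ^ (- l) *: ((x *m sx^* + sx *m x^*) *m J).

Local Notation Q := hyperbolic_projection.

Let ssx : s *m sx = x.
Proof. by rewrite mulmxA ss mul1mx. Qed.

Let h_sx_x : h sx x = w ^ l.
Proof. by rewrite hform_selfadjoint ?(hyp_pairing x_hyp) //; apply: linv_adj. Qed.

Let h_sx_sx : h sx sx = 0.
Proof.
by rewrite hform_selfadjoint ?ssx ?(hyp_isotropic x_hyp) //; apply: linv_adj.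
Qed.

Lemma mulmx_hyperbolic_projection (A : 'M_m) :
  A *m Q = w ^ (- l) *: ((A *m x *m sx^* + A *m sx *m x^*) *m J).
Proof. by rewrite -scalemxAr mulmxA mulmxDr !mulmxA. Qed.

Lemma hyperbolic_projection_cV (y : 'cV_m) :
  Q *m y = w ^ (- l) *: (h sx y *: x + h x y *: sx).
Proof. by rewrite -scalemxAl !mulmxDl !outer_mulmx. Qed.

Lemma hyperbolic_projection_id : Q *m x = x.
Proof.
rewrite hyperbolic_projection_cV h_sx_x (hyp_isotropic x_hyp) scale0r addr0.
by rewrite scalerA mulrC exprz_primeNK scale1r.
Qed.

Lemma hyperbolic_projection_id_s : Q *m sx = sx.
Proof.
rewrite hyperbolic_projection_cV h_sx_sx (hyp_pairing x_hyp) scale0r add0r.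
by rewrite scalerA mulrC exprz_primeNK scale1r.
Qed.

Lemma hyperbolic_projection_sub : P *m Q = Q.
Proof.
rewrite mulmx_hyperbolic_projection (hyp_image x_hyp).
by rewrite (stable_projection_image P_proj (hyp_image x_hyp)).
Qed.

Let selfadjoint_scale_mulJ S : S^* = S -> selfadjoint (w ^ (- l) *: (S *m J)).
Proof.
by move=> hS; rewrite scalemxAl; apply: selfadjoint_mulJ; rewrite ctrmxZ sigma_exprz_prime hS.
Qed.

Lemma hyperbolic_projection_adj : selfadjoint Q.
Proof. by apply: selfadjoint_scale_mulJ; rewrite ctrmxD !ctrmxM !ctrmxK // addrC. Qed.

Lemma hyperbolic_projection_comm : s *m Q = Q *m s.
Proof.
apply: selfadjoint_comm; [exact: linv_adj|exact: hyperbolic_projection_adj|].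
rewrite mulmx_hyperbolic_projection ssx -/sx; apply: selfadjoint_scale_mulJ.
by rewrite ctrmxD !ctrmxM !ctrmxK.
Qed.

(* With W := x - s x divisible by w ^ l, the matrix x (s x)^* + (s x) x^* equals
   2 x x^* - x W^* - W x^*. *)
Lemma hyperbolic_projection_int : mxge 0 Q.
Proof.
have l_le := hyperbolic_le s_inv x_hyp.
have x_int := hyp_int x_hyp; pose W := (1%:M - s) *m x.
have W_ge : mxge l W := involution_sub_ge (hyp_ge x_hyp) x_int (hyp_image x_hyp).
have sxE : sx = x - W by rewrite /W mulmxBl mul1mx subKr.
rewrite -(addNr l); apply: (mx_geZ hv); first exact: val_ge_exprz_prime.
apply: (mx_geMr hv) => //.
have -> : x *m sx^* + sx *m x^* = 2%:R *: (x *m x^*) - x *m W^* - W *m x^*.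
  by rewrite sxE ctrmxB mulmxBr mulmxBl scaler_nat mulr2n addrACA addrA.
have x_ctr_int := mx_ge_ctrmx x_int.
apply: (mx_geB hv); last exact: (mx_geMr hv).
apply: (mx_geB hv); last by apply: (mx_geMl hv) => //; apply: mx_ge_ctrmx.
by apply: (mx_geZr hv); [right|apply: (mx_geMl hv)].
Qed.

Lemma stable_hyperbolic_projection : stable_projection s Q.
Proof.
split.
- by rewrite mulmx_hyperbolic_projection hyperbolic_projection_id hyperbolic_projection_id_s.
- exact: hyperbolic_projection_adj.
- exact: hyperbolic_projection_comm.
- exact: hyperbolic_projection_int.
Qed.

Lemma stable_hyperbolic_complement : stable_projection s (P - Q).
Proof.
exact: stable_projectionB P_proj stable_hyperbolic_projection hyperbolic_projection_sub.
Qed.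

Lemma hyperbolic_complement_sub : P *m (P - Q) = P - Q.
Proof. by rewrite mulmxBr (sproj_idem P_proj) hyperbolic_projection_sub. Qed.

Lemma mxtrace_hyperbolic_projection : \tr Q = 2%:R.
Proof.
rewrite mxtraceZ mulmxDl mxtraceD !mxtrace_outer h_sx_x (hyp_pairing x_hyp).
by rewrite -mulr2n mulrnAr mulrC exprz_primeNK.
Qed.

Lemma mxtrace_mul_hyperbolic_projection : \tr (s *m Q) = 0.
Proof.
rewrite mulmx_hyperbolic_projection ssx -/sx mxtraceZ mulmxDl mxtraceD !mxtrace_outer.
by rewrite h_sx_sx (hyp_isotropic x_hyp) addr0 mulr0.
Qed.

Lemma orthogonal_to_hyperbolic q (E : 'M_(m, q)) :
  (P - Q) *m E = E -> gram sigma J x E = 0.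
Proof.
move=> <-; rewrite -gram_selfadjoint; last first.
  by apply: selfadjointB; [apply: sproj_adj P_proj|apply: hyperbolic_projection_adj].
rewrite mulmxBl (hyp_image x_hyp) hyperbolic_projection_id subrr.
by rewrite /gram ctrmx0 !mul0mx.
Qed.

End HyperbolicPlane.

Definition nonincreasing r (l : 'I_r -> int) : Prop :=
  forall a b : 'I_r, (a <= b)%N -> l b <= l a.

Lemma nonincreasing_cons r c (l : 'I_r -> int) :
  (forall a, l a <= c) -> nonincreasing l -> nonincreasing (cons_fun c l).
Proof.
move=> l_le l_sorted a b; case: (split_ordP a) => a' ->; case: (split_ordP b) => b' ->;
  rewrite ?cons_funl ?cons_funr //=.
- by rewrite ord1.
- by rewrite leq_add2l; apply: l_sorted.
Qed.

(* The columns of E and s E span an orthogonal sum of hyperbolic planes in the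
   image of P, and those of u its orthogonal complement, on which s is trivial. *)
Record adapted_frame (s P : 'M[F]_m) r b (l : 'I_r -> int)
    (E : 'M[F]_(m, r)) (u : 'M[F]_(m, b)) : Prop := {
  aframe_image : P *m E = E;
  aframe_int : mxge 0 E;
  aframe_displacement : mxge 0 ((E - s *m E) *m fdiag (fun a => w ^ l a));
  aframe_lower : forall a, - v 2%:R <= l a;
  aframe_upper : forall N a, mxge N ((1%:M - s) *m P) -> l a <= - N;
  aframe_sorted : nonincreasing l;
  aframe_isotropic : gram sigma J E E = 0;
  aframe_pairing : gram sigma J E (s *m E) = fdiag (fun a => w ^ (- l a));
  aframe_fixed_int : mxge 0 u;
  aframe_fixed_image : P *m u = u;
  aframe_fixed : s *m u = u;
  aframe_fixed_unit : gram sigma J u u = 1%:M;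
  aframe_fixed_orth : gram sigma J u E = 0 }.

Lemma adapted_frame_cons s P r b l x (lam : 'I_r -> int) E (u : 'M_(m, b)) :
  lattice_involution s -> stable_projection s P -> hyperbolic_vector s P l x ->
  adapted_frame s (P - hyperbolic_projection s l x) lam E u ->
  adapted_frame s P (cons_fun (- l) lam) (row_mx x E) u.
Proof.
move=> s_inv P_proj x_hyp; set P' := P - _ => frame.
have P'_proj : stable_projection s P' := stable_hyperbolic_complement s_inv P_proj x_hyp.
have PP' : P *m P' = P' := hyperbolic_complement_sub P_proj x_hyp.
have image_sub q (X : 'M_(m, q)) : P' *m X = X -> P *m X = X.
  by move=> <-; rewrite mulmxA PP'.
have orth q (X : 'M_(m, q)) : P' *m X = X -> gram sigma J x X = 0.
  exact: orthogonal_to_hyperbolic s_inv P_proj x_hyp q X.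
have orthC q (X : 'M_(m, q)) : P' *m X = X -> gram sigma J X x = 0.
  by move=> /orth xX; rewrite -gramC // xX ctrmx0.
have P'_ge : mxge l ((1%:M - s) *m P').
  by rewrite -PP' mulmxA; apply: (mx_geMr hv (hyp_ge x_hyp)); apply: sproj_int P'_proj.
have upper a : lam a <= - l by apply: aframe_upper frame _ _ P'_ge.
have l_le := hyperbolic_le s_inv x_hyp.
have sE_image := stable_projection_image P'_proj (aframe_image frame).
split.
- by rewrite mul_mx_row (hyp_image x_hyp) (image_sub _ _ (aframe_image frame)).
- exact: mx_ge_row (hyp_int x_hyp) (aframe_int frame).
- rewrite fdiag_cons mul_mx_row opp_row_mx add_row_mx mul_row_block !mulmx0 addr0 add0r.
  apply: mx_ge_row; last exact: aframe_displacement frame.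
  rewrite mul_mx_scalar -(addNr l); apply: (mx_geZ hv); first exact: val_ge_exprz_prime.
  have -> : x - s *m x = (1%:M - s) *m x by rewrite mulmxBl mul1mx.
  exact: involution_sub_ge (hyp_ge x_hyp) (hyp_int x_hyp) (hyp_image x_hyp).
- apply: (cons_fun_all (P := fun z => - v 2%:R <= z)); first by rewrite lerN2.
  exact: aframe_lower frame.
- move=> N a P_ge; have l_max := hyperbolic_max x_hyp P_ge.
  apply: (cons_fun_all (P := fun z => z <= - N)) => [|b']; first by rewrite lerN2.
  by apply: le_trans (upper b') _; rewrite lerN2.
- exact: nonincreasing_cons upper (aframe_sorted frame).
- rewrite gram_row gram_cV (hyp_isotropic x_hyp) (aframe_isotropic frame).
  by rewrite orth ?orthC ?(aframe_image frame) // raddf0 block_mx0.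
- rewrite mul_mx_row gram_row gram_cV (hyp_pairing x_hyp) (aframe_pairing frame).
  rewrite (fdiag_cons (fun z => w ^ (- z))) opprK.
  by rewrite orth // -gram_selfadjoint; [rewrite orthC|exact: linv_adj s_inv].
- exact: aframe_fixed_int frame.
- exact/image_sub/(aframe_fixed_image frame).
- exact: aframe_fixed frame.
- exact: aframe_fixed_unit frame.
- rewrite gram_rowr (aframe_fixed_orth frame) orthC ?row_mx0 //.
  exact: aframe_fixed_image frame.
Qed.

Lemma fixed_unit_vector s P : lattice_involution s -> stable_projection s P ->
  \tr P = 1 -> \tr (s *m P) = 1 ->
  exists u : 'cV_m, [/\ mxge 0 u, P *m u = u, s *m u = u & h u u = 1].
Proof.
move=> s_inv P_proj trP trsP; have PP := sproj_idem P_proj.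
have sP_eq_P : s *m P = P.
  pose Q := 2%:R^-1 *: ((1%:M - s) *m P).
  suff /eqP : Q = 0.
    by rewrite scaler_eq0 invr_eq0 (negPf two_neq0) mulmxBl mul1mx subr_eq0 => /eqP.
  apply: idempotent_trace0 (uinv_pchar U) _ _.
    rewrite /Q -scalemxAl -scalemxAr scalerA mulmxA -(mulmxA _ P) mulmxBr mulmx1.
    rewrite -(sproj_comm P_proj) -{1}[P]mul1mx -mulmxBl !mulmxA (involution_sub_sqr s_inv).
    by rewrite -mulmxA PP -scalemxAl scalerA -mulrA mulVf // mulr1.
  by rewrite mxtraceZ mulmxBl mul1mx raddfB /= trP trsP subrr mulr0.
have N1_inv : lattice_involution (- 1%:M).
  by apply: lattice_involutionN; split; [rewrite mulmx1|exact: selfadjoint1].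
have P_projN1 : stable_projection (- 1%:M) P.
  by case: P_proj => _ PJ _ P_int; split=> //; rewrite mulNmx mulmxN mul1mx mulmx1.
have twoE : 1%:M - - 1%:M = 2%:R *: 1%:M :> 'M[F]_m by rewrite opprK scaler_nat mulr2n.
have [|y y_att] := attains_scale_exists N1_inv P_projN1.
  rewrite twoE -scalemxAl mul1mx scaler_eq0 (negPf two_neq0) /=; apply/eqP => P0.
  by move: trP; rewrite P0 mxtrace0 => /esym/eqP; rewrite oner_eq0.
have v_le := attains_scale_le N1_inv y_att.
have v_ge : v 2%:R <= v (h y ((1%:M - - 1%:M) *m y)).
  apply: attains_scale_max y_att _; rewrite twoE -scalemxAl mul1mx.
  by apply: (mx_geZr hv); [right|exact: sproj_int P_proj].
case: y_att v_le v_ge => y_int Py; rewrite twoE -scalemxAl mul1mx hformZr => yy0 _ v_le v_ge.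
have c0 : h y y != 0 by move: yy0; rewrite mulf_eq0 negb_or => /andP[].
have c_unit : v (h y y) = 0 by move: v_le v_ge; rewrite (valM hv) //; lia.
have [|z z_unit zz] := norm_exprz_prime c0; first by rewrite -hformC.
rewrite c_unit expr0z in zz.
exists (z *: y); split.
- by apply: (mx_geZl hv) => //; apply: integer_unit_integer.
- by rewrite -scalemxAr Py.
- by rewrite -scalemxAr -{1}Py mulmxA sP_eq_P Py.
- by rewrite hformZl hformZr mulrA [sigma z * z]mulrC.
Qed.

Lemma fixed_unit_frame s P (b : bool) : lattice_involution s -> stable_projection s P ->
  \tr P = b%:R -> \tr (s *m P) = b%:R ->
  exists u : 'M_(m, b), [/\ mxge 0 u, P *m u = u, s *m u = u & gram sigma J u u = 1%:M].
Proof.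
case: b => /= s_inv P_proj trP trsP; last first.
  by exists 0; split; rewrite ?mulmx0 ?[LHS]flatmx0 ?[RHS]flatmx0 // => i [].
have [u [u_int Pu su uu]] := fixed_unit_vector s_inv P_proj trP trsP.
by exists u; rewrite gram_cV uu.
Qed.

Lemma adapted_frame_exists s (b : bool) r P :
  lattice_involution s -> stable_projection s P ->
  \tr P = (r.*2 + b)%:R -> \tr (s *m P) = b%:R ->
  exists l E (u : 'M_(m, b)), @adapted_frame s P r b l E u.
Proof.
move=> s_inv; elim: r P => [|r IH] P P_proj trP trsP.
  have [u [u_int Pu su uu]] := fixed_unit_frame s_inv P_proj trP trsP.
  exists (fun=> 0), 0, u; split; rewrite ?mulmx0 ?[LHS]thinmx0 ?[RHS]thinmx0 //;
    by [case|move=> ? []].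
have natr_neq0 n : n.+1%:R != 0 :> F by rewrite ((pcharf0P _).1 (uinv_pchar U)).
have [||l [x x_hyp]] := hyperbolic_exists s_inv P_proj.
- apply: contraNneq (natr_neq0 r.*2.+1) => /(congr1 mxtrace).
  by rewrite mxtrace0 mulmxBl mul1mx raddfB /= trP trsP natrD addrK -doubleS => ->.
- apply: contraNneq (natr_neq0 (r.*2.+1 + b + b)%N) => /(congr1 mxtrace).
  by rewrite mxtrace0 mulmxDl mul1mx raddfD /= trP trsP -natrD => ->.
have [||lam [E [u frame]]] := IH _ (stable_hyperbolic_complement s_inv P_proj x_hyp).
- rewrite raddfB /= trP (mxtrace_hyperbolic_projection s_inv x_hyp).
  by rewrite doubleS !addSn -addn2 natrD addrK.
- by rewrite mulmxBr raddfB /= trsP (mxtrace_mul_hyperbolic_projection s_inv x_hyp) subr0.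
by do 3 eexists; apply: adapted_frame_cons s_inv P_proj x_hyp frame.
Qed.

End HermitianLattices.

(** * Block matrices *)

Lemma char_poly_conj (F : fieldType) m (P A B : 'M[F]_m) :
  P \in unitmx -> A *m P = P *m B -> char_poly A = char_poly B.
Proof.
move=> P_unit AP; have -> : A = P *m B *m invmx P by rewrite -AP mulmxK.
rewrite /char_poly /char_poly_mx !map_mxM /=.
have PP : map_mx polyC P *m map_mx polyC (invmx P) = 1%:M by rewrite -map_mxM mulmxV // map_mx1.
rewrite -[X in X - _](mulmx1 'X%:M) -PP mulmxA -scalar_mxC -mulmxBl -mulmxBr.
by rewrite !det_mulmx mulrAC -det_mulmx PP det1 mul1r.
Qed.

Lemma mulmx1C_eq_dim (F : fieldType) m q (A : 'M[F]_(m, q)) (B : 'M[F]_(q, m)) :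
  q = m -> B *m A = 1%:M -> A *m B = 1%:M.
Proof. by move=> qm; subst q; apply: mulmx1C. Qed.

Section BlockMatrices.

Variables (F : fieldType) (sigma : {rmorphism F -> F}) (m : nat).

Local Notation n := (m./2).

Definition selector q (f : 'I_q -> 'I_m) : 'M[F]_(m, q) := \matrix_(i, a) (i == f a)%:R.

Lemma tr_selector_mulE q r (f : 'I_q -> 'I_m) (X : 'M_(m, r)) a j :
  ((selector f)^T *m X) a j = X (f a) j.
Proof.
rewrite mxE (bigD1 (f a)) //= !mxE eqxx mul1r big1 ?addr0 // => i ne.
by rewrite !mxE (negPf ne) mul0r.
Qed.

Lemma selector_orthonormal q (f : 'I_q -> 'I_m) :
  injective f -> (selector f)^T *m selector f = 1%:M.
Proof.
by move=> f_inj; apply/matrixP => a b; rewrite tr_selector_mulE !mxE inj_eq.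
Qed.

Lemma selector_orthogonal q r (f : 'I_q -> 'I_m) (g : 'I_r -> 'I_m) :
  (forall a b, f a != g b) -> (selector f)^T *m selector g = 0.
Proof.
by move=> fg; apply/matrixP => a b; rewrite tr_selector_mulE !mxE (negPf (fg a b)).
Qed.

Lemma diag_mx_selector q (d : 'rV[F]_m) (f : 'I_q -> 'I_m) :
  diag_mx d *m selector f = selector f *m fdiag (fun a => d 0 (f a)).
Proof.
rewrite mul_diag_mx mul_mx_diag; apply/matrixP => i a; rewrite !mxE.
by case: eqP => [->|]; rewrite ?(mulr0, mul0r, mulr1, mul1r).
Qed.

Lemma sum_delta_selector q (f g : 'I_q -> 'I_m) (c : 'I_q -> F) :
  \sum_a c a *: delta_mx (f a) (g a) = selector f *m fdiag c *m (selector g)^T.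
Proof.
apply/matrixP => i j; rewrite summxE !mxE; apply: eq_bigr => a _.
rewrite mul_mx_diag !mxE; case: (i == f a); case: (j == g a) => /=;
  by rewrite ?(mulr1, mul1r, mulr0, mul0r).
Qed.

Lemma ord_odd (b : bool) (i : 'I_b) : b.
Proof. by case: b i => // -[]. Qed.

Lemma ctrmx_selector q (f : 'I_q -> 'I_m) : ctrmx sigma (selector f) = (selector f)^T.
Proof. by apply/matrixP => a i; rewrite !mxE rmorph_nat. Qed.

Lemma half_lt_odd (i : 'I_(odd m)) : (n < m)%N.
Proof.
by have := odd_double_half m; rewrite (ord_odd i) -addnn; lia.
Qed.

(* The middle index, which exists for odd m only. *)
Definition mid (i : 'I_(odd m)) : 'I_m := Ordinal (half_lt_odd i).

Lemma half_double_le : (n + n <= m)%N.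
Proof. by rewrite addnn -{2}(odd_double_half m) leq_addl. Qed.

Lemma lo_inj : injective (@lo m).
Proof. by move=> a b /(congr1 val) h; apply: val_inj. Qed.

Lemma hi_inj : injective (@hi m).
Proof. by move=> a b /rev_ord_inj/lo_inj. Qed.

Lemma mid_inj : injective mid.
Proof. by move=> i j _; apply: val_inj; case: (odd m) i j => [i j|[]//]; rewrite !ord1. Qed.

Lemma lo_neq_hi a b : @lo m a != hi b.
Proof.
rewrite -(inj_eq val_inj) /=.
by have := ltn_ord a; have := ltn_ord b; have := half_double_le; lia.
Qed.

Lemma lo_neq_mid a i : @lo m a != mid i.
Proof. by rewrite -(inj_eq val_inj) /= ltn_eqF. Qed.

Lemma hi_neq_mid a i : @hi m a != mid i.
Proof.
rewrite -(inj_eq val_inj) /=; have := ltn_ord a.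
by have := odd_double_half m; rewrite (ord_odd i) -addnn; lia.
Qed.

Local Notation A := (selector (@lo m)).
Local Notation B := (selector (@hi m)).
Local Notation c := (selector mid).

Definition lo_hi_mid : 'M[F]_(m, n + n + odd m) := row_mx (row_mx A B) c.

Local Notation T := lo_hi_mid.

Lemma tr_lo_hi_mid_mul : T^T *m T = 1%:M.
Proof.
have tr0 q r (X : 'M[F]_(m, q)) (Y : 'M[F]_(m, r)) : X^T *m Y = 0 -> Y^T *m X = 0.
  by move=> XY; apply: trmx_inj; rewrite trmx_mul trmxK XY trmx0.
have AB := selector_orthogonal lo_neq_hi.
have Ac := selector_orthogonal lo_neq_mid; have Bc := selector_orthogonal hi_neq_mid.
rewrite tr_row_mx mul_col_row tr_row_mx mul_col_row mul_col_mx mul_mx_row AB Ac Bc.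
rewrite !(tr0 _ _ _ _ AB, tr0 _ _ _ _ Ac, tr0 _ _ _ _ Bc).
rewrite !selector_orthonormal; [|exact: mid_inj|exact: hi_inj|exact: lo_inj].
by rewrite row_mx0 col_mx0 -!scalar_mx_block.
Qed.

Lemma lo_hi_mid_mul_tr : T *m T^T = 1%:M.
Proof.
by apply: mulmx1C_eq_dim tr_lo_hi_mid_mul; rewrite addnn addnC odd_double_half.
Qed.

Lemma ctrmx_tr_lo_hi_mid : ctrmx sigma T^T = T.
Proof.
rewrite /ctrmx trmxK !map_row_mx; congr (row_mx (row_mx _ _) _);
  by apply/matrixP => i a; rewrite !mxE rmorph_nat.
Qed.

Lemma ctrmx_lo_hi_mid : ctrmx sigma T = T^T.
Proof. by rewrite -[in RHS]ctrmx_tr_lo_hi_mid /ctrmx map_trmx !trmxK. Qed.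

(* The matrix acting by [X, Y; Z, W] in the basis of the lo's and hi's and fixing
   the middle vector. *)
Definition blk (X Y Z W : 'M[F]_n) : 'M[F]_m :=
  T *m block_mx (block_mx X Y Z W) 0 0 1%:M *m T^T.

Lemma eq_blk X Y Z W X' Y' Z' W' :
  X = X' -> Y = Y' -> Z = Z' -> W = W' -> blk X Y Z W = blk X' Y' Z' W'.
Proof. by move=> -> -> -> ->. Qed.

Lemma blkE X Y Z W :
  blk X Y Z W = A *m X *m A^T + A *m Y *m B^T + B *m Z *m A^T + B *m W *m B^T + c *m c^T.
Proof.
rewrite /blk !tr_row_mx !mul_row_block !mulmx0 mulmx1 addr0 add0r !mul_row_col.
by rewrite !mulmxDl addrACA !addrA.
Qed.

Lemma blkM X Y Z W X' Y' Z' W' : blk X Y Z W *m blk X' Y' Z' W' =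
  blk (X *m X' + Y *m Z') (X *m Y' + Y *m W') (Z *m X' + W *m Z') (Z *m Y' + W *m W').
Proof.
rewrite /blk -!mulmxA (mulmxA T^T) tr_lo_hi_mid_mul mul1mx (mulmxA (block_mx _ _ _ _)).
by rewrite !mulmx_block !(mul0mx, mulmx0) !(addr0, add0r) mulmx1.
Qed.

Lemma blk1 : blk 1%:M 0 0 1%:M = 1%:M.
Proof. by rewrite /blk -!scalar_mx_block mulmx1 lo_hi_mid_mul_tr. Qed.

Lemma ctrmx_blk X Y Z W : ctrmx sigma (blk X Y Z W) =
  blk (ctrmx sigma X) (ctrmx sigma Z) (ctrmx sigma Y) (ctrmx sigma W).
Proof.
rewrite /blk !ctrmxM ctrmx_tr_lo_hi_mid ctrmx_lo_hi_mid !ctrmx_block !ctrmx0 ctrmx1.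
exact: mulmxA.
Qed.

Lemma blkB X Y Z W X' Y' Z' W' : blk X Y Z W - blk X' Y' Z' W' =
  A *m (X - X') *m A^T + A *m (Y - Y') *m B^T + B *m (Z - Z') *m A^T + B *m (W - W') *m B^T.
Proof.
rewrite !blkE !mulmxBr !mulmxBl opprD addrACA subrr addr0.
by rewrite !opprD addrACA [X in X + _]addrACA [X in X + _ + _]addrACA.
Qed.

Lemma hi_blk_hi X Y Z W : B^T *m blk X Y Z W *m B = W.
Proof.
have TB : T^T *m B = col_mx (col_mx 0 1%:M) 0.
  have <- : T *m col_mx (col_mx 0 1%:M) 0 = B.
    by rewrite !mul_row_col !mulmx0 mulmx1 add0r addr0.
  by rewrite mulmxA tr_lo_hi_mid_mul mul1mx.
have BT : B^T *m T = row_mx (row_mx 0 1%:M) 0.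
  by apply: trmx_inj; rewrite trmx_mul trmxK TB !tr_row_mx !trmx0 trmx1.
rewrite /blk !mulmxA BT -mulmxA TB !mul_row_block !mul_row_col.
rewrite !(mulmx0, mul0mx, add0r, addr0) !mul1mx mul_row_col mulmx0 mulmx1.
exact: add0r.
Qed.

Lemma blk_mid X Y Z W : blk X Y Z W *m c = c.
Proof.
have cE : c = T *m col_mx 0 1%:M by rewrite mul_row_col mulmx0 mulmx1 add0r.
rewrite {2}cE /blk -!mulmxA {1}cE (mulmxA T^T) tr_lo_hi_mid_mul mul1mx.
by rewrite mul_block_col !(mulmx0, mul0mx, add0r) mulmx1.
Qed.

Lemma diag_mx_blk (d : 'rV[F]_m) : (forall i, d 0 (mid i) = 1) ->
  diag_mx d = blk (fdiag (fun a => d 0 (lo a))) 0 0 (fdiag (fun a => d 0 (hi a))).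
Proof.
move=> d_mid; rewrite -[LHS]mulmx1 -lo_hi_mid_mul_tr mulmxA /blk; congr (_ *m _).
rewrite !mul_mx_row !diag_mx_selector !mul_row_block !mulmx0 !addr0 !add0r.
by rewrite (fdiag_scalar d_mid).
Qed.

Definition frame (E F' : 'M[F]_(m, n)) (u : 'M[F]_(m, odd m)) : 'M[F]_m :=
  row_mx (row_mx E F') u *m T^T.

Lemma mulmx_frame (s : 'M[F]_m) E F' u X Y Z W :
  s *m E = E *m X + F' *m Z -> s *m F' = E *m Y + F' *m W -> s *m u = u ->
  s *m frame E F' u = frame E F' u *m blk X Y Z W.
Proof.
move=> sE sF su; rewrite /frame /blk -!mulmxA (mulmxA T^T) tr_lo_hi_mid_mul mul1mx !mulmxA.
by rewrite !mul_mx_row !mul_row_block !mulmx0 !addr0 add0r mulmx1 sE sF su.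
Qed.

Lemma frame_gram (J : 'M[F]_m) E F' u :
  involutive sigma -> ctrmx sigma J = J ->
  gram sigma J E E = 0 -> gram sigma J E F' = 1%:M -> gram sigma J F' F' = 0 ->
  gram sigma J u u = 1%:M -> gram sigma J u E = 0 -> gram sigma J u F' = 0 ->
  gram sigma J (frame E F' u) (frame E F' u) = blk 0 1%:M 1%:M 0.
Proof.
move=> sigmaK J_herm EE EF FF uu uE uF.
have gC p q (X : 'M_(m, p)) (Y : 'M_(m, q)) := gramC X Y sigmaK J_herm.
rewrite /gram ctrmxM ctrmx_tr_lo_hi_mid -!mulmxA (mulmxA J).
rewrite (mulmxA (ctrmx _ _)) (mulmxA (ctrmx _ _)) -/(gram _ _ _ _).
rewrite !gram_row gram_rowr gram_rowl EE EF FF uu uE uF.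
rewrite -(gC _ _ E F') EF -(gC _ _ u E) uE -(gC _ _ u F') uF ctrmx1 !ctrmx0.
by rewrite row_mx0 col_mx0 /blk mulmxA.
Qed.

Definition exchange_mx : 'M[F]_m := \matrix_(i, j) (j == rev_ord i)%:R.

Local Notation J := exchange_mx.

Lemma exchange_mx_selector q (f : 'I_q -> 'I_m) :
  J *m selector f = selector (@rev_ord m \o f).
Proof.
apply/matrixP => i a; rewrite !mxE (bigD1 (rev_ord i)) //= !mxE eqxx mul1r big1 ?addr0.
  by rewrite (can2_eq rev_ordK rev_ordK).
by move=> j ne; rewrite !mxE (negPf ne) mul0r.
Qed.

Lemma exchange_mx_lo : J *m A = B.
Proof. exact: exchange_mx_selector. Qed.

Lemma exchange_mx_hi : J *m B = A.
Proof. by rewrite exchange_mx_selector; apply/matrixP => i a; rewrite !mxE /= rev_ordK. Qed.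

Lemma exchange_mx_mid : J *m c = c.
Proof.
rewrite exchange_mx_selector; apply/matrixP => i a; rewrite !mxE; congr (_ == _)%:R.
apply: val_inj => /=; have := odd_double_half m.
by rewrite (ord_odd a) -addnn; lia.
Qed.

Lemma exchange_mx_blk : J = blk 0 1%:M 1%:M 0.
Proof.
rewrite -[LHS]mulmx1 -lo_hi_mid_mul_tr mulmxA /blk; congr (_ *m _).
rewrite !mul_mx_row !mul_row_block exchange_mx_lo exchange_mx_hi exchange_mx_mid.
by rewrite !mulmx0 !mulmx1 !addr0 !add0r.
Qed.

Lemma exchange_mxK : J *m J = 1%:M.
Proof. by rewrite exchange_mx_blk blkM !(mul0mx, mul1mx, add0r, addr0) blk1. Qed.

Lemma tr_exchange_mx : J^T = J.
Proof. by apply/matrixP => i j; rewrite !mxE eq_sym (can2_eq rev_ordK rev_ordK). Qed.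

Lemma ctrmx_exchange_mx : ctrmx sigma J = J.
Proof. by rewrite /ctrmx tr_exchange_mx; apply/matrixP => i j; rewrite !mxE rmorph_nat. Qed.

Lemma mxtrace_exchange_mx : \tr J = (odd m)%:R.
Proof.
rewrite exchange_mx_blk /blk mxtrace_mulC mulmxA tr_lo_hi_mid_mul mul1mx.
by rewrite !mxtrace_block !mxtrace0 mxtrace1 !add0r.
Qed.

Lemma mx_ge_exchange_mx (v : F -> int) : normalized_valuation v -> mx_ge v 0 J.
Proof. by move=> hv i j; rewrite mxE; apply: (val_ge_nat hv). Qed.

Lemma mx_ge_selector (v : F -> int) q (f : 'I_q -> 'I_m) :
  normalized_valuation v -> mx_ge v 0 (selector f).
Proof. by move=> hv i j; rewrite mxE; apply: (val_ge_nat hv). Qed.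

Lemma frame_int (v : F -> int) E F' u : normalized_valuation v ->
  mx_ge v 0 E -> mx_ge v 0 F' -> mx_ge v 0 u -> mx_ge v 0 (frame E F' u).
Proof.
move=> hv hE hF hu; apply: (mx_geMl hv); first by do 2 apply: mx_ge_row => //.
have T_int : mx_ge v 0 T by apply: mx_ge_row; [apply: mx_ge_row|]; apply: mx_ge_selector.
by move=> a i; rewrite mxE.
Qed.

End BlockMatrices.

(** * Isometries and the representatives *)

Section Isometries.

Variables (F : fieldType) (sigma : {rmorphism F -> F}) (m : nat).
Hypothesis sigmaK : involutive sigma.

Local Notation J := (exchange_mx F m).
Local Notation "X ^*" := (ctrmx sigma X) : ring_scope.

Definition isometry (g : 'M[F]_m) : Prop := gram sigma J g g = J.

Lemma isometry_mulV g : isometry g -> g *m (J *m g^* *m J) = 1%:M.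
Proof.
move=> gg; apply: mulmx1C.
by rewrite -!mulmxA [g^* *m _]mulmxA -/(gram _ _ _ _) gg exchange_mxK.
Qed.

Lemma isometry_ctrmx g : isometry g -> g *m J *m g^* = J.
Proof.
move=> /isometry_mulV /(congr1 (mulmxr J)) /=.
by rewrite mul1mx -!mulmxA exchange_mxK mulmx1 !mulmxA.
Qed.

Lemma isometry1 : isometry 1%:M.
Proof. by rewrite /isometry /gram ctrmx1 mul1mx mulmx1. Qed.

Lemma isometryM g g' : isometry g -> isometry g' -> isometry (g *m g').
Proof. by move=> gg gg'; rewrite /isometry gram_mulr gram_mull gg. Qed.

Lemma isometryV g : isometry g -> isometry (J *m g^* *m J).
Proof.
move=> gg; rewrite /isometry /gram !ctrmxM ctrmx_exchange_mx ctrmxK //.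
transitivity (J *m (g *m (J *m J) *m J *m g^*) *m J); first by rewrite !mulmxA.
by rewrite exchange_mxK mulmx1 isometry_ctrmx // exchange_mxK mul1mx.
Qed.

Lemma hermitian_isometryP x : x^* = x -> isometry x <-> (x *m J) *m (x *m J) = 1%:M.
Proof.
move=> x_herm; rewrite /isometry /gram x_herm; split=> [xJx|xx].
  by rewrite mulmxA xJx exchange_mxK.
by rewrite -[LHS]mulmx1 -(exchange_mxK F m) mulmxA -(mulmxA _ x) xx mul1mx.
Qed.

Lemma conj_of_intertwining (x x' g : 'M[F]_m) : isometry g ->
  x *m J *m g = g *m (x' *m J) -> x = g *m x' *m g^*.
Proof.
move=> /isometry_mulV g_inv xg.
have -> : x = x *m J *m g *m (J *m g^*).
  rewrite -[LHS]mulmx1 -(exchange_mxK F m) mulmxA -[x *m J in LHS]mulmx1 -g_inv.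
  by rewrite -!mulmxA exchange_mxK mulmx1.
by rewrite xg -!mulmxA (mulmxA J J) exchange_mxK mul1mx.
Qed.

Definition conjugate (H : 'M[F]_m -> Prop) (x y : 'M[F]_m) : Prop :=
  exists2 g, H g & x = g *m y *m g^*.

Record isometry_subgroup (H : 'M[F]_m -> Prop) : Prop := {
  isub_isometry : forall g, H g -> isometry g;
  isub1 : H 1%:M;
  isubM : forall g g', H g -> H g' -> H (g *m g');
  isubV : forall g, H g -> H (J *m g^* *m J) }.

Lemma isometry_subgroup_full : isometry_subgroup isometry.
Proof. by split; [|exact: isometry1|exact: isometryM|exact: isometryV]. Qed.

Section Conjugacy.

Variable H : 'M[F]_m -> Prop.
Hypothesis H_sub : isometry_subgroup H.

Lemma conjugate_refl x : conjugate H x x.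
Proof. by exists 1%:M; [exact: isub1|rewrite ctrmx1 mul1mx mulmx1]. Qed.

Lemma conjugate_trans y x z : conjugate H x y -> conjugate H y z -> conjugate H x z.
Proof.
move=> [g Hg ->] [g' Hg' ->].
by exists (g *m g'); [exact: isubM|rewrite ctrmxM !mulmxA].
Qed.

Lemma conjugate_sym x y : conjugate H x y -> conjugate H y x.
Proof.
move=> [g Hg ->]; exists (J *m g^* *m J); first exact: isubV.
have := isometry_mulV (isub_isometry H_sub Hg); set h := J *m g^* *m J => /mulmx1C hg.
have gh : g^* *m h^* = 1%:M by rewrite -ctrmxM hg ctrmx1.
by rewrite !mulmxA hg mul1mx -mulmxA gh mulmx1.
Qed.

End Conjugacy.

End Isometries.

Definition theta_if_neg (F : fieldType) (theta : F) (z : int) : F :=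
  if 0 <= z then 0 else theta.

Definition xblk (F : fieldType) m (w theta : F) (l : 'I_m./2 -> int) : 'M[F]_m :=
  blk (fdiag (fun a => w ^ l a * (1 - theta_if_neg theta (l a) ^+ 2)))
      (fdiag (fun a => - theta_if_neg theta (l a)))
      (fdiag (fun a => theta_if_neg theta (l a))) (fdiag (fun a => w ^ (- l a))).

Lemma xblk_nonneg (F : fieldType) m (w theta : F) (l : 'I_m./2 -> int) :
  (forall a, 0 <= l a) ->
  xblk w theta l = blk (fdiag (fun a => w ^ l a)) 0 0 (fdiag (fun a => w ^ (- l a))).
Proof.
move=> l_ge0; have t0 a : theta_if_neg theta (l a) = 0 by rewrite /theta_if_neg l_ge0.
apply: eq_blk.
- by apply: eq_fdiag => a; rewrite t0 expr0n subr0 mulr1.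
- by apply: fdiag_eq0 => a; rewrite t0 oppr0.
- exact: fdiag_eq0.
- by [].
Qed.

Lemma xblk0 (F : fieldType) m (w theta : F) : xblk w theta (fun _ : 'I_m./2 => 0) = 1%:M.
Proof. by rewrite xblk_nonneg // oppr0 expr0z !(@fdiag_scalar _ _ _ 1) ?blk1. Qed.

Section Representatives.

Variables (F : fieldType) (sigma : {rmorphism F -> F}) (v : F -> int) (w theta : F).
Hypothesis U : unramified_involution sigma v w theta.
Variable m : nat.

Local Notation n := (m./2).
Local Notation J := (exchange_mx F m).
Local Notation "X ^*" := (ctrmx sigma X) : ring_scope.
Local Notation t := (theta_if_neg theta).
Local Notation D := fdiag.
Local Notation x_ := (@xblk F m w theta).
Local Notation gram := (gram sigma J).

Let sigmaK := uinv_involutive U.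
Let wK := exprz_primeNK U.

Let wVK z : w ^ (- z) * w ^ z = 1.
Proof. by rewrite mulrC wK. Qed.

Lemma sigma_theta_if_neg z : sigma (t z) = - t z.
Proof. by rewrite /theta_if_neg; case: ifP => _; rewrite ?rmorph0 ?oppr0 // (uinv_theta U). Qed.

Lemma exprz_prime_theta_int z : - v 2%:R <= z -> val_ge v 0 (w ^ z * (1 + t z)).
Proof.
move=> z_ge; rewrite /theta_if_neg; case: ifP => z0.
  by rewrite addr0 mulr1; right; rewrite (val_exprz_prime U).
have [theta1 v_theta1] := uinv_one_add_theta U.
right; rewrite (valM (uinv_valuation U)) ?(exprz_prime_neq0 U) //.
by rewrite (val_exprz_prime U) v_theta1 -lerBlDr sub0r.
Qed.

Lemma ctrmx_xblk l : (x_ l)^* = x_ l.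
Proof.
rewrite ctrmx_blk !ctrmx_fdiag; apply: eq_blk; apply: eq_fdiag => a /=.
- by rewrite rmorphM rmorphB rmorph1 rmorphXn /= sigma_theta_if_neg (sigma_exprz_prime U) sqrrN.
- exact: sigma_theta_if_neg.
- by rewrite rmorphN /= sigma_theta_if_neg opprK.
- exact: (sigma_exprz_prime U).
Qed.

Lemma xblk_mulJ l : x_ l *m J =
  blk (D (fun a => - t (l a))) (D (fun a => w ^ l a * (1 - t (l a) ^+ 2)))
      (D (fun a => w ^ (- l a))) (D (fun a => t (l a))).
Proof. by rewrite exchange_mx_blk blkM !(mulmx0, mulmx1, add0r, addr0). Qed.

Lemma xblk_mulJK l : (x_ l *m J) *m (x_ l *m J) = 1%:M.
Proof.
rewrite xblk_mulJ blkM -(blk1 F m) !fdiagM !fdiagD; apply: eq_blk.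
- by apply: fdiag_scalar => a; rewrite mulrAC wK; ring.
- by apply: fdiag_eq0 => a; ring.
- by apply: fdiag_eq0 => a; ring.
- by apply: fdiag_scalar => a; rewrite mulrA wVK; ring.
Qed.

Lemma xblk_isometry l : isometry sigma (x_ l).
Proof. by apply/hermitian_isometryP; [exact: ctrmx_xblk|exact: xblk_mulJK]. Qed.

Lemma xblk_char_poly l : char_poly (x_ l *m J) = char_poly J.
Proof.
pose g : 'M[F]_m := blk 1%:M (D (fun a => - t (l a))) 0 (D (fun a => w ^ (- l a))).
pose g' : 'M[F]_m := blk 1%:M (D (fun a => t (l a) * w ^ l a)) 0 (D (fun a => w ^ l a)).
have gg' : g *m g' = 1%:M.
  rewrite blkM -(blk1 F m) !(mul0mx, mulmx0, mul1mx, addr0, add0r) !fdiagM fdiagD.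
  apply: eq_blk; [by []| |by []|].
    by apply: fdiag_eq0 => a; ring.
  by apply: fdiag_scalar => a; apply: wVK.
have [g_unit _] := mulmx1_unit gg'.
apply: char_poly_conj g_unit _; rewrite xblk_mulJ exchange_mx_blk !blkM.
rewrite !(mul0mx, mulmx0, mul1mx, mulmx1, addr0, add0r) !fdiagM !fdiagD.
apply: eq_blk; [by []| |by []|].
  by apply: fdiag_scalar => a; rewrite mulrAC wK; ring.
by apply: fdiag_eq0 => a; ring.
Qed.

(* For s to act on the planes through the blocks of x_l, the second vector of each
   plane must be w ^ l (s e + t e). *)
Section FrameConjugation.

Variables (x : 'M[F]_m) (l : 'I_n -> int) (E : 'M[F]_(m, n)) (u : 'M[F]_(m, odd m)).
Let s := x *m J.
Let E' := (s *m E + E *m D (fun a => t (l a))) *m D (fun a => w ^ l a).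

Hypotheses (x_herm : x^* = x) (x_isometry : isometry sigma x).
Hypotheses (EE : gram E E = 0) (EsE : gram E (s *m E) = D (fun a => w ^ (- l a))).
Hypotheses (uu : gram u u = 1%:M) (su : s *m u = u) (uE : gram u E = 0).

Let ss : s *m s = 1%:M.
Proof. exact: (hermitian_isometryP x_herm).1 x_isometry. Qed.

Let s_adj : selfadjoint sigma J s.
Proof. by rewrite /selfadjoint ctrmxM ctrmx_exchange_mx x_herm mulmxA. Qed.

Lemma frame_conj_gram :
  [/\ gram E E' = 1%:M, gram E' E' = 0 & gram u E' = 0].
Proof.
have gC p q (X : 'M_(m, p)) (Y : 'M_(m, q)) := gramC X Y sigmaK (ctrmx_exchange_mx sigma m).
have sEE : gram (s *m E) E = D (fun a => w ^ (- l a)).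
  rewrite -gC EsE ctrmx_fdiag; apply: eq_fdiag => a /=; exact: (sigma_exprz_prime U).
have sEsE : gram (s *m E) (s *m E) = 0 by rewrite (gram_selfadjoint _ _ s_adj) mulmxA ss mul1mx.
have gramE'r q (X : 'M_(m, q)) :
    gram X E' = (gram X (s *m E) + gram X E *m D (fun a => t (l a))) *m D (fun a => w ^ l a).
  by rewrite [LHS]gram_mulr gramDr [gram X (E *m _)]gram_mulr.
have gramE'l q (X : 'M_(m, q)) : gram E' X = D (fun a => w ^ l a) *m
    (gram (s *m E) X - D (fun a => t (l a)) *m gram E X).
  rewrite [LHS]gram_mull gramDl [gram (E *m _) X]gram_mull -mulNmx.
  rewrite !ctrmx_fdiag fdiagN (eq_fdiag (fun a => sigma_exprz_prime U (l a))).
  by rewrite (eq_fdiag (fun a => sigma_theta_if_neg (l a))).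
split; rewrite gramE'r.
- by rewrite EE mul0mx addr0 EsE fdiagM; apply: fdiag_scalar => a; apply: wVK.
- rewrite !gramE'l sEsE EsE sEE EE mulmx0 subr0 sub0r fdiagM fdiagN !fdiagM fdiagD fdiagM.
  by apply: fdiag_eq0 => a; ring.
- by rewrite uE mul0mx addr0 -(gram_selfadjoint _ _ s_adj) su uE mul0mx.
Qed.

Lemma frame_conj :
  isometry sigma (frame E E' u) /\ x = frame E E' u *m x_ l *m (frame E E' u)^*.
Proof.
have [EE' E'E' uE'] := frame_conj_gram.
have frame_isometry : isometry sigma (frame E E' u).
  by rewrite /isometry frame_gram ?ctrmx_exchange_mx // -exchange_mx_blk.
split=> //; apply: conj_of_intertwining => //; rewrite xblk_mulJ; apply: mulmx_frame => //.
- have DwK : D (fun a => w ^ l a) *m D (fun a => w ^ (- l a)) = 1%:M.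
    by rewrite fdiagM; apply: fdiag_scalar => a; apply: wK.
  rewrite /E' -(mulmxA _ _ (D (fun a => w ^ (- l a)))) DwK mulmx1 addrCA -mulmxDr fdiagD.
  by rewrite (fdiag_eq0 (fun a => addNr (t (l a)))) mulmx0 addr0.
- have -> : s *m E' = (E + s *m E *m D (fun a => t (l a))) *m D (fun a => w ^ l a).
    by rewrite mulmxA mulmxDr (mulmxA s s) ss mul1mx (mulmxA s E).
  rewrite /E' !mulmxDl -!(mulmxA _ (D _)) !fdiagM [RHS]addrCA addrC -mulmxDr fdiagD.
  by congr (_ + _); congr (_ *m _); apply: eq_fdiag => a; ring.
Qed.

End FrameConjugation.

End Representatives.

(** * Invariants of a conjugacy class *)

Lemma exists_truncated_vanishing (F : fieldType) n (M : 'M[F]_n) (i : 'I_n) :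
  exists2 x : 'rV_n, x != 0 &
    (forall a : 'I_n, (i < a)%N -> x 0 a = 0) /\
    (forall b : 'I_n, (b < i)%N -> (x *m M) 0 b = 0).
Proof.
pose Z : 'M[F]_n := \matrix_(a, b)
  if (b < i)%N then M a b else if b == i then 0 else (a == b)%:R.
have Z_sing : \det Z == 0.
  rewrite (expand_det_col _ i) big1 // => a _.
  by rewrite mxE ltnn eqxx mul0r.
have [x x0 xZ] := det0P Z_sing; exists x => //.
have xZE b : \sum_a x 0 a * Z a b = 0 by have /matrixP/(_ 0 b) := xZ; rewrite !mxE.
split=> [a ia|b bi].
  have ne : (a == i) = false by rewrite -(inj_eq val_inj) gtn_eqF.
  have := xZE a; rewrite (bigD1 a) //= big1 ?addr0 => [|b ba].
    by rewrite mxE ltnNge ltnW // ne eqxx mulr1.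
  by rewrite mxE ltnNge ltnW // ne (negPf ba) mulr0.
by rewrite mxE -[RHS](xZE b); apply: eq_bigr => a _; rewrite !mxE bi.
Qed.

Section Invariants.

Variables (F : fieldType) (sigma : {rmorphism F -> F}) (v : F -> int) (w theta : F).
Hypothesis U : unramified_involution sigma v w theta.

Local Notation "X ^*" := (ctrmx sigma X) : ring_scope.
Local Notation t := (theta_if_neg theta).
Local Notation D := fdiag.
Local Notation Dw l := (fdiag (fun a => w ^ (- l a))).
Local Notation mxge := (mx_ge v).

Let hv := uinv_valuation U.

Section DiagonalForms.

Variables (n : nat) (P : 'M[F]_n) (l mu : 'I_n -> int).
Hypothesis PDP : P *m Dw l *m P^* = Dw mu.

(* If l i < mu i, take a nonzero x supported in {0, ..., i} such that
   y := x D(w^mu) P vanishes before i. Then x = y D(w^-l) P^* would be divisible by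
   w times its least entry. *)
Lemma diagonal_form_dominance : mxge 0 P -> nonincreasing l -> nonincreasing mu ->
  forall i, mu i <= l i.
Proof.
move=> P_int l_sorted mu_sorted i; rewrite leNgt; apply/negP => l_lt.
have [x x0 [x_gt y_lt]] := exists_truncated_vanishing (D (fun a => w ^ mu a) *m P) i.
have [z [d]] := mx_least_entry v x0; rewrite (ord1 z) => -[xd x_ge].
have xE : x = x *m (D (fun a => w ^ mu a) *m P) *m Dw l *m P^*.
  rewrite -!mulmxA (mulmxA P) PDP fdiagM (fdiag_scalar (c := 1)) ?mulmx1 // => a.
  exact: exprz_primeNK U _.
have y_ge : mxge (v (x 0 d) + 1) (x *m (D (fun a => w ^ mu a) *m P) *m Dw l).
  move=> j b; rewrite (ord1 j) mul_mx_diag mxE [(\row__ _) _ _]mxE.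
  have [bi|ib] := ltnP b i; first by rewrite y_lt // mul0r; left.
  rewrite mxE mulr_suml; apply: (val_ge_sum hv) => a _; rewrite mul_diag_mx !mxE.
  have [ia|ai] := ltnP i a; first by rewrite (x_gt a) // !mul0r; left.
  have -> : x 0 a * (w ^ mu a * P a b) * w ^ (- l b) =
     x 0 a * (w ^ (mu a - l b) * P a b) by rewrite (exprz_primeD U); ring.
  apply: (val_geM hv) => //; apply: (val_geMr hv) => //.
  apply: val_ge_le (val_ge_exprz_prime U _).
  by have := l_sorted i b ib; have := mu_sorted a i ai; lia.
have : val_ge v (v (x 0 d) + 1) (x 0 d).
  by rewrite {2}xE; apply: (mx_geMr hv y_ge); apply: (mx_ge_ctrmx U).
by move=> /(val_geE xd); rewrite gerDl.
Qed.

Lemma diagonal_form_parity : (2 %| \sum_a l a - \sum_a mu a)%Z.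
Proof.
have det_Dw (f : 'I_n -> int) : \det (Dw f) = w ^ (- \sum_a f a).
  rewrite det_diag -sumrN; under eq_bigr do rewrite mxE.
  elim/big_rec2: _ => [|a y z _ ->]; first by rewrite expr0z.
  by rewrite (exprz_primeD U).
have := congr1 determinant PDP.
rewrite !det_mulmx !det_Dw /ctrmx det_map_mx det_tr => det_eq.
have P0 : \det P != 0.
  by apply: contraNneq (exprz_prime_neq0 U (- \sum_a mu a)) => P0; rewrite -det_eq P0 !mul0r.
have := congr1 v det_eq.
rewrite !(valM hv) ?mulf_neq0 ?fmorph_eq0 ?(exprz_prime_neq0 U) //.
rewrite (uinv_val U) !(val_exprz_prime U) => val_eq.
apply/dvdzP; exists (v (\det P)).
by move: (v _) (\sum_a l a) (\sum_a mu a) val_eq => c L M; lia.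
Qed.

End DiagonalForms.

Variable m : nat.

Local Notation n := (m./2).
Local Notation J := (exchange_mx F m).
Local Notation x_ := (@xblk F m w theta).
Local Notation A := (selector F (@lo m)).
Local Notation B := (selector F (@hi m)).

Lemma xblk_sub_exchange (l : 'I_n -> int) :
  let C := B - A *m D (fun a => w ^ l a * (1 + t (l a))) in
  x_ l - J = C *m Dw l *m C^*.
Proof.
pose D1 := D (fun a => w ^ l a * (1 + t (l a))); pose D2 := D (fun a => w ^ l a * (1 - t (l a))).
move=> C; have -> : C^* = B^T - D2 *m A^T.
  rewrite ctrmxB ctrmxM !ctrmx_selector ctrmx_fdiag; congr (_ - _ *m _).
  apply: eq_fdiag => a /=.
  by rewrite rmorphM rmorphD rmorph1 /= (sigma_theta_if_neg U) (sigma_exprz_prime U).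
have D1w : D1 *m Dw l = - (D (fun a => - t (l a)) - 1%:M).
  rewrite -(fdiag_scalar (r := n) (fun=> erefl 1)) fdiagN fdiagD fdiagN fdiagM.
  apply: eq_fdiag => a.
  by rewrite mulrAC (exprz_primeNK U); ring.
have wD2 : Dw l *m D2 = - (D (fun a => t (l a)) - 1%:M).
  rewrite -(fdiag_scalar (r := n) (fun=> erefl 1)) fdiagN fdiagD fdiagN fdiagM.
  apply: eq_fdiag => a.
  by rewrite mulrA [w ^ (- _) * _]mulrC (exprz_primeNK U); ring.
have D1wD2 : D1 *m Dw l *m D2 = D (fun a => w ^ l a * (1 - t (l a) ^+ 2)).
  rewrite !fdiagM; apply: eq_fdiag => a.
  rewrite -mulrA [w ^ (- _) * _]mulrA [w ^ (- _) * _]mulrC (exprz_primeNK U) mul1r.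
  by ring.
rewrite exchange_mx_blk /xblk blkB !subr0 /C.
have -> : (B - A *m D1) *m Dw l *m (B^T - D2 *m A^T) =
    B *m Dw l *m B^T - B *m (Dw l *m D2) *m A^T
    - (A *m (D1 *m Dw l) *m B^T - A *m (D1 *m Dw l *m D2) *m A^T).
  by rewrite !mulmxBl !mulmxBr !mulmxA.
rewrite D1wD2 D1w wD2 !(mulmxN, mulNmx) opprB !opprK.
by rewrite [RHS]addrC [X in _ = _ + X]addrC addrA.
Qed.

Lemma conjugate_diagonal_form (l mu : 'I_n -> int) g : isometry sigma g ->
  x_ mu = g *m x_ l *m g^* ->
  exists2 P : 'M[F]_n, P *m Dw l *m P^* = Dw mu &
    mxge 0 g -> (forall a, - v 2%:R <= l a) -> mxge 0 P.
Proof.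
move=> g_iso x_mu; set C := B - A *m D (fun a => w ^ l a * (1 + t (l a))).
exists (B^T *m g *m C).
  have -> : (B^T *m g *m C)^* = C^* *m g^* *m B.
    by rewrite !ctrmxM -(ctrmx_selector sigma) ctrmxK ?mulmxA //; apply: uinv_involutive U.
  have -> : B^T *m g *m C *m Dw l *m (C^* *m g^* *m B) =
      B^T *m (g *m (C *m Dw l *m C^*) *m g^*) *m B by rewrite !mulmxA.
  rewrite -xblk_sub_exchange mulmxBr mulmxBl -x_mu isometry_ctrmx //.
  by rewrite mulmxBr mulmxBl exchange_mx_blk !hi_blk_hi subr0.
move=> g_int l_ge; apply: (mx_geMl hv).
  apply: (mx_geMl hv) => // a i; rewrite mxE; exact: mx_ge_selector.
apply: (mx_geB hv); first exact: mx_ge_selector.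
apply: (mx_geMl hv); first exact: mx_ge_selector.
by apply: mx_ge_fdiag => a; apply: (exprz_prime_theta_int U).
Qed.

End Invariants.

(** * Reduction to the representatives *)

Lemma diagonal_form_embed (F : fieldType) (sigma : {rmorphism F -> F}) n q
    (f : 'I_q -> 'I_n) (M : 'M[F]_q) (d d' : 'I_n -> F) :
  injective f -> (forall i, (forall a, i != f a) -> d i = d' i) ->
  ctrmx sigma M *m fdiag (d \o f) *m M = fdiag (d' \o f) ->
  exists T : 'M_n, ctrmx sigma T *m fdiag d *m T = fdiag d'.
Proof.
move=> f_inj d_out MDM; pose S := selector F f; pose Q := 1%:M - S *m S^T.
have SS : S^T *m S = 1%:M := selector_orthonormal F f_inj.
have DS (c : 'I_n -> F) : fdiag c *m S = S *m fdiag (c \o f).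
  by rewrite diag_mx_selector; congr (_ *m _); apply: eq_fdiag => a; rewrite mxE.
have SD (c : 'I_n -> F) : S^T *m fdiag c = fdiag (c \o f) *m S^T.
  by apply: trmx_inj; rewrite !trmx_mul !trmxK !tr_diag_mx DS.
have QS : Q *m S = 0 by rewrite mulmxBl mul1mx -mulmxA SS mulmx1 subrr.
have SQ : S^T *m Q = 0 by rewrite mulmxBr mulmx1 mulmxA SS mul1mx subrr.
have S_ctr := ctrmx_selector sigma f; have ST_ctr : ctrmx sigma S^T = S.
  by rewrite /ctrmx -map_trmx -/(ctrmx sigma S) S_ctr trmxK.
have DQ : fdiag d *m Q = fdiag d' *m Q.
  apply/matrixP => i j; rewrite !mul_diag_mx !mxE.
  have [[a ->]|no] := pselect (exists a, i = f a).
    by have := tr_selector_mulE f Q a j; rewrite -/S SQ !mxE => <-; rewrite !mulr0.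
  by rewrite d_out // => a; apply/eqP => ia; apply: no; exists a.
exists (Q + S *m M *m S^T).
have -> : ctrmx sigma (Q + S *m M *m S^T) = Q + S *m ctrmx sigma M *m S^T.
  by rewrite ctrmxD ctrmxB ctrmx1 !ctrmxM ST_ctr S_ctr mulmxA.
have Q_add : Q + S *m 1%:M *m S^T = 1%:M by rewrite mulmx1 subrK.
clearbody Q.
have sandwich (N N' : 'M_q) (c : 'I_n -> F) :
    (Q + S *m N *m S^T) *m fdiag c *m (Q + S *m N' *m S^T) =
    Q *m (fdiag c *m Q) + S *m (N *m fdiag (c \o f) *m N') *m S^T.
  have QDS : Q *m fdiag c *m S = 0 by rewrite -mulmxA DS mulmxA QS mul0mx.
  have SDQ : S^T *m fdiag c *m Q = 0 by rewrite SD -mulmxA SQ mulmx0.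
  have SDS : S^T *m fdiag c *m S = fdiag (c \o f) by rewrite SD -mulmxA SS mulmx1.
  rewrite mulmxDr !mulmxDl !mulmxA QDS !mul0mx add0r -(mulmxA (S *m N) S^T (fdiag c)).
  by rewrite -!(mulmxA (S *m N) (S^T *m fdiag c)) SDQ SDS mulmx0 addr0.
have := sandwich 1%:M 1%:M d'; rewrite Q_add !mul1mx !mulmx1 => ->.
by rewrite sandwich MDM DQ.
Qed.

Section IsometryClasses.

Variables (F : fieldType) (sigma : {rmorphism F -> F}) (v : F -> int) (w theta : F).
Hypothesis U : unramified_involution sigma v w theta.
Variable m : nat.

Local Notation n := (m./2).
Local Notation "X ^*" := (ctrmx sigma X) : ring_scope.
Local Notation t := (theta_if_neg theta).
Local Notation D := fdiag.
Local Notation Dw l := (fdiag (fun a => w ^ (- l a))).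
Local Notation J := (exchange_mx F m).
Local Notation x_ := (@xblk F m w theta).
Local Notation A := (selector F (@lo m)).
Local Notation B := (selector F (@hi m)).
Local Notation c := (selector F (@mid m)).
Local Notation gram := (gram sigma J).
Local Notation isometry_class l mu := (conjugate sigma (isometry sigma (m := m)) (x_ l) (x_ mu)).

Let hv := uinv_valuation U.
Let sigmaK := uinv_involutive U.

Lemma isometry_class_of_diagonal_form (T : 'M[F]_n) (l mu : 'I_n -> int) :
  T^* *m Dw l *m T = Dw mu -> isometry_class l mu.
Proof.
move=> TDT; have AJ : A^T *m J = B^T by rewrite -exchange_mx_lo trmx_mul tr_exchange_mx.
have BA : B^T *m A = 0.
  by apply: trmx_inj; rewrite trmx_mul trmxK trmx0; apply: selector_orthogonal (@lo_neq_hi m).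
have cB : c^T *m B = 0.
  by apply: trmx_inj; rewrite trmx_mul trmxK trmx0; apply: selector_orthogonal (@hi_neq_mid m).
have cc : c^T *m c = 1%:M := selector_orthonormal F (@mid_inj m).
have [|||||frame_iso x_conj] := frame_conj U (x := x_ l) (l := mu) (E := A *m T) (u := c)
    (ctrmx_xblk U l) (xblk_isometry U l).
- by rewrite gram_mulr gram_mull /gram ctrmx_selector AJ BA mulmx0 mul0mx.
- rewrite gram_mull (mulmxA (x_ l *m J)) [gram A (_ *m T)]gram_mulr mulmxA.
  by rewrite /gram ctrmx_selector AJ -(mulmxA (x_ l)) exchange_mx_lo (mulmxA B^T) hi_blk_hi.
- by rewrite /gram ctrmx_selector -mulmxA exchange_mx_mid.
- by rewrite -mulmxA exchange_mx_mid blk_mid.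
- by rewrite gram_mulr /gram ctrmx_selector -(mulmxA c^T) exchange_mx_lo cB mul0mx.
by eexists; [exact: frame_iso|exact: x_conj].
Qed.

Lemma isometry_class_trans l2 l1 l3 :
  isometry_class l1 l2 -> isometry_class l2 l3 -> isometry_class l1 l3.
Proof. exact/conjugate_trans/isometry_subgroup_full. Qed.

Lemma isometry_class_even_shift (l mu z : 'I_n -> int) :
  (forall a, l a = mu a + z a *+ 2) -> isometry_class l mu.
Proof.
move=> shift; apply: (@isometry_class_of_diagonal_form (D (fun a => w ^ z a))).
rewrite ctrmx_fdiag !fdiagM; apply: eq_fdiag => a /=.
by rewrite (sigma_exprz_prime U) -!(exprz_primeD U); congr (_ ^ _); rewrite shift; ring.
Qed.

Lemma int_half_parity (z : int) : z = (z %/ 2)%Z *+ 2 + (~~ (2 %| z)%Z)%:Z.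
Proof.
have := divz_eq z 2; have := modz_ge0 z (isT : 2 != 0 :> int); have := @ltz_pmod z 2 isT.
by have [/dvdz_mod0P ->|/dvdz_mod0P odd_z] := boolP (2 %| z)%Z; rewrite /=; lia.
Qed.

Lemma binary_form_represents_one (p q : int) : exists t0 t1 : F,
  t0 * sigma t0 * w ^ (- p) + t1 * sigma t1 * w ^ (- q) = 1.
Proof.
move: (p %/ 2)%Z (~~ _) (int_half_parity p) => p' bp ->.
move: (q %/ 2)%Z (~~ _) (int_half_parity q) => q' bq ->.
have norm_w (z : int) (b : bool) :
    w ^ z * sigma (w ^ z) * w ^ (- (z *+ 2 + b%:Z)) = w ^ (- b%:Z).
  by rewrite (sigma_exprz_prime U) -!(exprz_primeD U); congr (_ ^ _); ring.
case: bp; last first.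
  by exists (w ^ p'), 0; rewrite norm_w !mul0r addr0 oppr0 expr0z.
case: bq; last first.
  by exists 0, (w ^ q'); rewrite norm_w !mul0r add0r oppr0 expr0z.
have [w0 vw] := uinv_prime U; have sw := uinv_fixed_prime U.
have u_unit : integer_unit v (w - 1).
  apply: (integer_unit_near hv ltr01 (integer_unitN hv (integer_unit1 hv))).
  by rewrite opprK subrK; right; rewrite vw.
have [|z _ norm_z] := uinv_norm_unit U u_unit; first by rewrite rmorphB rmorph1 sw.
exists (w ^ p'), (w ^ q' * z).
rewrite rmorphM norm_w mulrACA norm_z [X in _ + X]mulrAC norm_w exprN1.
by field.
Qed.

Lemma isometry_class_merge (l : 'I_n -> int) (a0 a1 : 'I_n) : a0 != a1 ->
  isometry_class l (fun a => if a == a0 then l a0 + l a1 else if a == a1 then 0 else l a).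
Proof.
move=> a01; have [t0 [t1 norm1]] := binary_form_represents_one (l a0) (l a1).
pose f : 'I_(1 + 1) -> 'I_n := cons_fun a0 (fun=> a1).
pose M : 'M[F]_(1 + 1) := block_mx (- w ^ (- l a1) * sigma t1)%:M t0%:M
  (w ^ (- l a0) * sigma t0)%:M t1%:M.
have fdiag2 (c : 'I_n -> F) : D (c \o f) = block_mx (c a0)%:M 0 0 (c a1)%:M.
  by rewrite fdiag_cons (fdiag_scalar (c := c a1)).
have [||| T TDT] := @diagonal_form_embed F sigma n _ f M (fun a => w ^ (- l a))
  (fun a => w ^ (- (if a == a0 then l a0 + l a1 else if a == a1 then 0 else l a))).
- move=> i j; rewrite /f; case: (split_ordP i) => i' ->; case: (split_ordP j) => j' ->;
    by rewrite ?cons_funl ?cons_funr ?ord1 // => /eqP; rewrite ?(eq_sym a1) (negPf a01).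
- move=> i i_out; have := i_out (lshift 1 ord0); have := i_out (rshift 1 ord0).
  by rewrite /f cons_funl cons_funr => /negPf -> /negPf ->.
- rewrite !fdiag2 eqxx [a1 == a0]eq_sym (negPf a01) eqxx oppr0 expr0z.
  rewrite ctrmx_block !ctrmx_scalar !mulmx_block !(mulmx0, mul0mx, addr0, add0r) -!scalar_mxM.
  rewrite -!raddfD /= -(raddf0 (@scalar_mx F 1)) !rmorphM rmorphN !sigmaK !(sigma_exprz_prime U).
  congr (block_mx _%:M _%:M _%:M _%:M); rewrite ?opprD ?(exprz_primeD U);
    last by rewrite -[RHS]norm1; ring.
  + by rewrite -[RHS]mulr1 -norm1; ring.
  + by ring.
  + by ring.
by apply: isometry_class_of_diagonal_form TDT.
Qed.

Lemma isometry_class_concentrate (l : 'I_n -> int) (a0 : 'I_n) :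
  isometry_class l (fun a => if a == a0 then \sum_a l a else 0).
Proof.
have [N] := ubnP #|[set a | (a != a0) && (l a != 0)]%SET|; elim: N l => // N IH l lN.
have [[a1 /andP[a10 la1]]|no] := pselect (exists a, (a != a0) && (l a != 0)); last first.
  have l0 a : a != a0 -> l a = 0.
    by move=> aa0; apply/eqP; apply: contrapT => la; apply: no; exists a; rewrite aa0; apply/negP.
  apply: (isometry_class_even_shift (z := fun=> 0)) => a; rewrite mul0rn addr0.
  have [->|/l0 //] := eqVneq a a0.
  by rewrite (bigD1 a0) //= big1 ?addr0 // => b /l0.
pose l' a := if a == a0 then l a0 + l a1 else if a == a1 then 0 else l a.
have sum_l' : \sum_a l' a = \sum_a l a.
  rewrite (bigD1 a0) //= (bigD1 a1) //= [RHS](bigD1 a0) //= [in RHS](bigD1 a1) //=.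
  rewrite /l' eqxx (negPf a10) eqxx add0r addrA; congr (_ + _); apply: eq_bigr => a /andP[aa0 aa1].
  by rewrite (negPf aa0) (negPf aa1).
rewrite eq_sym in a10.
apply: isometry_class_trans (isometry_class_merge l a10) _; rewrite -sum_l'; apply: IH.
rewrite -ltnS; apply: leq_trans lN; rewrite ltnS; apply: proper_card; apply/properP; split.
  apply/fintype.subsetP => a; rewrite !inE /l' => /andP[aa0]; rewrite (negPf aa0) /=.
  by case: ifP => // _; rewrite ?eqxx.
by exists a1; rewrite !inE eq_sym ?a10 // /l' eq_sym (negPf a10) eqxx eqxx.
Qed.

Lemma isometry_class_parity (l : 'I_n -> int) (a0 : 'I_n) :
  isometry_class l (fun a => if (2 %| \sum_a l a)%Z then 0 else (a == a0)%:Z).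
Proof.
set S := \sum_a l a; apply: isometry_class_trans (isometry_class_concentrate l a0) _.
apply: (isometry_class_even_shift (z := fun a => if a == a0 then (S %/ 2)%Z else 0)) => a.
case: (a == a0); last by rewrite mul0rn addr0; case: ifP.
by rewrite -/S {1}(int_half_parity S) addrC; case: ifP.
Qed.

Lemma isometry_class_dvd2_sum (l mu : 'I_n -> int) :
  isometry_class mu l -> (2 %| \sum_a l a - \sum_a mu a)%Z.
Proof.
move=> [g g_iso /(conjugate_diagonal_form U g_iso)[P PDP _]].
exact: (diagonal_form_parity U PDP).
Qed.

Definition integral_isometry (g : 'M[F]_m) : Prop := isometry sigma g /\ mx_ge v 0 g.

Lemma integral_isometry_subgroup : isometry_subgroup sigma integral_isometry.
Proof.
have J_int : mx_ge v 0 J by apply: mx_ge_exchange_mx.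
split=> [g []//||g g' [g_iso g_int] [g'_iso g'_int]|g [g_iso g_int]].
- by split; [exact: isometry1|apply: mx_ge_scalar; apply: (val_ge_nat hv 1)].
- by split; [exact: isometryM|exact: (mx_geMl hv)].
- split; first exact: isometryV.
  by apply: (mx_geMl hv) => //; apply: (mx_geMl hv) => //; apply: (mx_ge_ctrmx U).
Qed.

Lemma integral_conjugate_le (l mu : 'I_n -> int) :
  nonincreasing l -> nonincreasing mu -> (forall a, - v 2%:R <= l a) ->
  conjugate sigma integral_isometry (x_ mu) (x_ l) -> forall a, mu a <= l a.
Proof.
move=> l_sorted mu_sorted l_ge [g [g_iso g_int] /(conjugate_diagonal_form U g_iso)[P PDP P_int]].
exact: (diagonal_form_dominance U PDP (P_int g_int l_ge)).
Qed.

Lemma hermitian_isometry_representative x :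
  x^* = x -> isometry sigma x -> \tr (x *m J) = (odd m)%:R ->
  exists l, [/\ nonincreasing l, forall a, - v 2%:R <= l a &
                conjugate sigma integral_isometry x (x_ l)].
Proof.
move=> x_herm x_iso tr_x; have J_herm := ctrmx_exchange_mx sigma m.
have J_int : mx_ge v 0 J by apply: mx_ge_exchange_mx.
have s_inv : lattice_involution sigma J (x *m J).
  split; first exact: (hermitian_isometryP x_herm).1 x_iso.
  by rewrite /selfadjoint ctrmxM J_herm x_herm mulmxA.
have [||l [E [u []]]] := adapted_frame_exists U (exchange_mxK F m) J_herm J_int
    (r := n) (b := odd m) s_inv (stable_projection1 U J (x *m J)).
- by rewrite mxtrace1 addnC odd_double_half.
- by rewrite mulmx1.
move=> _ E_int diff_int l_ge _ l_sorted EE EsE u_int _ su uu uE.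
exists l; split=> //.
have [frame_iso x_conj] := frame_conj U x_herm x_iso EE EsE uu su uE.
eexists; [split; [exact: frame_iso|]|exact: x_conj].
apply: (frame_int hv) => //.
have -> : (x *m J *m E + E *m D (fun a => t (l a))) *m D (fun a => w ^ l a) =
    E *m D (fun a => w ^ l a * (1 + t (l a))) - (E - x *m J *m E) *m D (fun a => w ^ l a).
  set s := x *m J; set Dl := D (fun a => w ^ l a).
  have -> : D (fun a => w ^ l a * (1 + t (l a))) = Dl + D (fun a => t (l a)) *m Dl.
    by rewrite fdiagM fdiagD; apply: eq_fdiag => a; ring.
  by rewrite !mulmxDl mulmxDr mulNmx opprD opprK mulmxA addrACA subrr add0r addrC.
apply: (mx_geB hv) => //; apply: (mx_geMl hv) => //.
by apply: mx_ge_fdiag => a; apply: (exprz_prime_theta_int U).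
Qed.

End IsometryClasses.

(** * Orbits *)

Section LocalFieldRepresentatives.

Variables (k : fieldType) (k' : fieldExtType k) (m : nat) (pi : k) (theta : k').

Lemma x_middle_selector : x_middle k' m = selector k' (@mid m) *m (selector k' (@mid m))^T.
Proof.
apply/matrixP => i j; rewrite !mxE.
under eq_bigr do rewrite !mxE -!(inj_eq val_inj) /= -natrM mulnb.
by case: (odd m) => /=; rewrite ?big_ord0 ?big_ord1.
Qed.

Lemma x_lambda_xblk (eps : k) (l : {ffun 'I_m./2 -> int}) : theta ^+ 2 = eps%:A ->
  x_lambda pi eps theta l = xblk pi%:A theta l.
Proof.
move=> sqr_theta; rewrite /x_lambda x_middle_selector /xblk blkE -!sum_delta_selector.
congr (_ + _); rewrite -!big_split; apply: eq_bigr => a _ /=.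
have in_algXz z : (pi ^ z)%:A = pi%:A ^ z :> k' by rewrite -(fmorphXz (in_alg k') z pi).
rewrite /x_block /theta_if_neg -!in_algXz; case: ifP => _.
  by rewrite expr0n subr0 mulr1 oppr0 !scale0r !addr0.
have -> : (pi ^ l a * (1 - eps))%:A = (pi ^ l a)%:A * (1 - theta ^+ 2) :> k'.
  have -> : 1 - theta ^+ 2 = (1 - eps)%:A by rewrite sqr_theta scalerBl scale1r.
  exact: in_algM.
by rewrite scaleNr.
Qed.

Lemma x_one_xblk (a0 : 'I_m./2) : val a0 = 0%N ->
  x_one k' m pi = xblk pi%:A theta (fun a => (a == a0)%:Z).
Proof.
move=> a0E; have half_gt0 := ltn_ord a0; have half_le := half_double_le m.
rewrite xblk_nonneg // /x_one diag_mx_blk => [|i].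
  apply: eq_blk; [|by []|by []|]; apply: eq_fdiag => a;
    rewrite mxE -(inj_eq val_inj) a0E /=; have a_lt := ltn_ord a.
    have -> : (val a == m.-1) = false by rewrite /=; lia.
    by case: eqP => _; rewrite ?expr1z.
  have -> : (m - a.+1 == 0)%N = false by lia.
  have -> : (m - a.+1 == m.-1)%N = (val a == 0%N) by rewrite /=; lia.
  case: eqP => _; last by rewrite oppr0 expr0z.
  by rewrite exprN1; apply: (fmorphV (in_alg k')).
rewrite mxE /=; have := odd_double_half m; rewrite (ord_odd i) -addnn => m_odd.
have -> : (m./2 == 0)%N = false by lia.
by have -> : (m./2 == m.-1)%N = false by lia.
Qed.

End LocalFieldRepresentatives.

Section UnitaryOrbits.

Variables (k : fieldType) (k' : fieldExtType k) (sigma : {lrmorphism k' -> k'}).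
Variables (m : nat) (v : k' -> int) (w theta : k').
Hypothesis U : unramified_involution sigma v w theta.

Local Notation n := (m./2).
Local Notation G := (unitary_group sigma (m := m)).
Local Notation K := (integral_unitary_group sigma (m := m) v).
Local Notation X := (herm_space sigma (m := m)).
Local Notation x_ := (@xblk k' m w theta).

Lemma unitary_groupE : G = isometry sigma (m := m) :> ('M[k']_m -> Prop).
Proof.
apply/seteqP; split=> g /= => [[]//|g_iso]; split=> //.
by have [] := mulmx1_unit (isometry_mulV g_iso).
Qed.

Lemma integral_unitary_groupE : K = integral_isometry sigma v (m := m) :> ('M[k']_m -> Prop).
Proof. by rewrite /integral_unitary_group unitary_groupE. Qed.

Lemma orbit_ofP (H : set 'M[k']_m) x y : orbit_of sigma H y x <-> conjugate sigma H x y.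
Proof. by split=> -[g Hg e]; exists g. Qed.

Lemma orbit_of_eqP (H : set 'M[k']_m) x y : isometry_subgroup sigma H ->
  orbit_of sigma H x = orbit_of sigma H y <-> conjugate sigma H x y.
Proof.
move=> H_sub; split=> [xy|xy].
  by apply/orbit_ofP; rewrite -xy; apply/orbit_ofP; apply: conjugate_refl.
apply/seteqP; split=> z /orbit_ofP zx; apply/orbit_ofP.
  exact: conjugate_trans zx xy.
exact/(conjugate_trans H_sub zx)/conjugate_sym.
Qed.

Lemma integral_orbit_eqP x y :
  orbit_of sigma K x = orbit_of sigma K y <->
  conjugate sigma (integral_isometry sigma v (m := m)) x y.
Proof.
rewrite -integral_unitary_groupE; apply: orbit_of_eqP.
by rewrite integral_unitary_groupE; apply: integral_isometry_subgroup U m.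
Qed.

Lemma unitary_orbit_eqP x y :
  orbit_of sigma G x = orbit_of sigma G y <-> conjugate sigma (isometry sigma (m := m)) x y.
Proof.
rewrite -unitary_groupE; apply: orbit_of_eqP.
by rewrite unitary_groupE; apply: isometry_subgroup_full (uinv_involutive U).
Qed.

Lemma herm_space_xblk l : X (x_ l).
Proof.
split; first by rewrite unitary_groupE; apply: (xblk_isometry U).
- exact: (ctrmx_xblk U).
- exact: (xblk_char_poly U).
Qed.

Lemma integral_orbit_xblk x : (0 < m)%N -> X x ->
  exists2 l : {ffun 'I_n -> int}, Lambda (v 2%:R) l & orbit_of sigma K x = orbit_of sigma K (x_ l).
Proof.
move=> m_gt0 [x_unitary x_herm x_char]; rewrite unitary_groupE in x_unitary.
have tr_x : \tr (x *m antidiag k' m) = (odd m)%:R.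
  apply: oppr_inj; rewrite -char_poly_trace // x_char char_poly_trace //.
  by rewrite -(mxtrace_exchange_mx k' m).
have [l [l_sorted l_ge x_conj]] := hermitian_isometry_representative U x_herm x_unitary tr_x.
exists [ffun a => l a]; first by split=> [a b ab|a]; rewrite !ffunE // l_sorted.
have -> : x_ [ffun a => l a] = x_ l by congr xblk; apply: funext => a; rewrite ffunE.
exact/integral_orbit_eqP.
Qed.

Lemma integral_orbit_inj (l mu : {ffun 'I_n -> int}) :
  Lambda (v 2%:R) l -> Lambda (v 2%:R) mu ->
  orbit_of sigma K (x_ l) = orbit_of sigma K (x_ mu) -> l = mu.
Proof.
move=> [l_sorted l_ge] [mu_sorted mu_ge] eq_orb; apply/ffunP => a; apply/eqP.
have l_mu := (integral_orbit_eqP _ _).1 eq_orb.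
have mu_l := (integral_orbit_eqP _ _).1 (esym eq_orb).
have mu_le := integral_conjugate_le U l_sorted mu_sorted l_ge mu_l a.
have l_le := integral_conjugate_le U mu_sorted l_sorted mu_ge l_mu a.
by rewrite eq_le mu_le l_le.
Qed.

Section Parity.

Variable a0 : 'I_n.

Let l1 (a : 'I_n) : int := (a == a0)%:Z.

Lemma unitary_orbit_parity (l : 'I_n -> int) :
  orbit_of sigma G (x_ l) = orbit_of sigma G (if (2 %| \sum_a l a)%Z then 1%:M else x_ l1).
Proof.
rewrite -(xblk0 m w theta); have := isometry_class_parity U l a0.
by case: ifP => _ /unitary_orbit_eqP.
Qed.

Lemma unitary_orbit1_parity (l : 'I_n -> int) :
  orbit_of sigma G 1%:M (x_ l) <-> (2 %| \sum_a l a)%Z.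
Proof.
split=> [/orbit_ofP|even_l].
  rewrite unitary_groupE -(xblk0 m w theta) => /(isometry_class_dvd2_sum U).
  by rewrite big1 // sub0r !dvdzE abszN.
apply/orbit_ofP; rewrite unitary_groupE; apply/unitary_orbit_eqP.
by have := unitary_orbit_parity l; rewrite even_l.
Qed.

Lemma unitary_orbit_basepoint_neq : orbit_of sigma G 1%:M <> orbit_of sigma G (x_ l1).
Proof.
move=> eq_orb; have : orbit_of sigma G 1%:M (x_ l1).
  by apply/orbit_ofP; rewrite unitary_groupE; apply/unitary_orbit_eqP; rewrite eq_orb.
by rewrite unitary_orbit1_parity (bigD1 a0) //= /l1 eqxx big1 ?addr0 // => a /negPf ->.
Qed.

Lemma unitary_orbit_space : (0 < m)%N -> orbit_space sigma G =
  [set orbit_of sigma G 1%:M; orbit_of sigma G (x_ l1)]%classic.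
Proof.
move=> m_gt0; apply/seteqP; split=> [_ [x Xx <-]|_ [->|->]].
- have [l _ /integral_orbit_eqP[g [g_iso _] x_conj]] := integral_orbit_xblk m_gt0 Xx.
  have x_l : orbit_of sigma G x = orbit_of sigma G (x_ l) by apply/unitary_orbit_eqP; exists g.
  by have := etrans x_l (unitary_orbit_parity l); case: ifP => _ xE; [left|right].
- by exists 1%:M; rewrite // -(xblk0 m w theta); apply: herm_space_xblk.
- by exists (x_ l1) => //; apply: herm_space_xblk.
Qed.

End Parity.

End UnitaryOrbits.

Local Open Scope classical_set_scope.
Local Open Scope ring_scope.

Theorem theorem1p1
  (p : nat) (Qp : fieldType) (vp : Qp -> int) (hQp : is_Qp p vp)
  (k : fieldExtType Qp) (v : k -> int) (hv : normalized_valuation v)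
  (hk : exists r : nat, ramification_index vp v r)
  (pi : k) (hpi : prime_element v pi)
  (k' : fieldExtType k) (v' : k' -> int) (hv' : normalized_valuation v')
  (hk' : unramified_quadratic v v')
  (sigma : {lrmorphism k' -> k'}) (hsigma : nontrivial_automorphism sigma)
  (eps : k) (heps : integer_unit v eps)
  (sqrt_eps : k') (hsqrt : sqrt_eps ^+ 2 = eps%:A)
  (hbasis : integral_basis2 v v' 1 ((1 + sqrt_eps) / 2%:R))
  (m : nat) (hm : (2 <= m)%N) :
  let e := v 2%:R in
  let X := herm_space sigma (m := m) in
  let G := unitary_group sigma (m := m) in
  let K := integral_unitary_group sigma (m := m) v' in
  let xl := x_lambda pi eps sqrt_eps (m := m) in
  let KX := orbit_space sigma K in
  let Korb := fun l => orbit_of sigma K (xl l) in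
  [/\ (forall l, Lambda e l -> X (xl l)) /\ set_surj (Lambda e) KX Korb,
      (~~ odd m \/ m = 3%N \/ e = 1) -> set_bij (Lambda e) KX Korb
    & [/\ X 1%:M /\ X (x_one k' m pi),
          orbit_space sigma G =
            [set orbit_of sigma G 1%:M; orbit_of sigma G (x_one k' m pi)],
          orbit_of sigma G 1%:M <> orbit_of sigma G (x_one k' m pi)
        & forall l, Lambda e l ->
            (orbit_of sigma G 1%:M (xl l) <-> (2 %| \sum_a l a)%Z)]].
Proof.
move=> e X G K xl KX Korb; have [r hr] := hk.
have k_pchar := fieldExt_pchar0 k (Qp_pchar hQp).
have U := unramified_quadratic_involution hv (finite_extension_complete hQp hv hr)
  (finite_extension_residues hQp hv hr) k_pchar hpi hv' hk'.2 hsigma heps hsqrt hbasis.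
have eE : v' 2%:R = e := val_ext_natS k_pchar hk'.2 1.
have xlE l : xl l = xblk pi%:A sqrt_eps l := x_lambda_xblk _ _ hsqrt.
have m_gt0 : (0 < m)%N := ltnW hm; have half_m_gt0 : (0 < m./2)%N by rewrite half_gt0.
have x1E := x_one_xblk pi sqrt_eps (erefl (val (Ordinal half_m_gt0))).
have X_xl l : X (xl l) by rewrite xlE; apply: herm_space_xblk U _.
have surj : set_surj (Lambda e) KX Korb.
  move=> _ [x Xx <-]; have [l Ll ->] := integral_orbit_xblk U m_gt0 Xx.
  by exists l; rewrite -?eE /Korb ?xlE.
split; first by [].
  move=> _; split=> // [l _|l mu /set_mem Ll /set_mem Lmu]; first exact: imageP (X_xl l).
  by rewrite -eE in Ll Lmu; rewrite /Korb !xlE; apply: integral_orbit_inj.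
rewrite x1E; split.
- by rewrite -(xblk0 m pi%:A sqrt_eps); split; apply: herm_space_xblk U _.
- exact: unitary_orbit_space U _ m_gt0.
- exact: unitary_orbit_basepoint_neq U _.
- by move=> l _; rewrite xlE; apply: unitary_orbit1_parity U (Ordinal half_m_gt0) l.
Qed.
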